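(* Let $\mathfrak R$ be a complete, separated right linear topological ring. The class of all $1$-strictly flat left $\mathfrak R$-contramodules is closed under direct limits in $\mathfrak R\text{-contra}$.
   Context: Rings are associative and unital. A topological ring $\mathfrak R$ is right linear if its open right ideals form a base of neighborhoods of zero; it is separated and complete if the natural map $\mathfrak R\to\varprojlim_{\mathfrak I}\mathfrak R/\mathfrak I$ ($\mathfrak I$ ranging over the open right ideals) is injective and surjective, respectively. Contramodules. For an abelian group $A$ and a set $X$, $A[X]=A^{(X)}$ is the direct sum of $X$ copies of $A$. For a set $X$, $\mathfrak R[[X]]=\varprojlim_{\mathfrak I}(\mathfrak R/\mathfrak I)[X]\subset\mathfrak R^X$ is the set of all formal linear combinations $\sum_{x\in X}r_xx$ whose family of coefficients converges to zero, i.e., for every open right ideal $\mathfrak I$ the set $\{x: r_x\notin\mathfrak I\}$ is finite. A map $f\colon X\to Y$ induces $\sum_x r_xx\mapsto\sum_y\bigl(\sum_{f(x)=y}r_x\bigr)y$ (infinite sums are limits of finite partial sums in $\mathfrak R$). With the unit $\epsilon_X\colon X\to\mathfrak R[[X]]$, $x\mapsto 1\cdot x$, and the ''opening of parentheses'' map $\phi_X\colon\mathfrak R[[\mathfrak R[[X]]]]\to\mathfrak R[[X]]$ (multiply coefficients and take the convergent sums), $\mathfrak R[[-]]$ is a monad on the category of sets. A left $\mathfrak R$-contramodule is an algebra over this monad, i.e., a set $\mathfrak C$ with a contraaction map $\pi_{\mathfrak C}\colon\mathfrak R[[\mathfrak C]]\to\mathfrak C$ satisfying associativity and unitality. Left $\mathfrak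 R$-contramodules form a cocomplete abelian category $\mathfrak R\text{-contra}$ with enough projectives; the projectives are the direct summands of the free contramodules $\mathfrak R[[X]]$. Strict flatness. A right $\mathfrak R$-module $\mathcal N$ is discrete if the annihilator of every element of $\mathcal N$ is an open right ideal. For a discrete right $\mathfrak R$-module $\mathcal N$ and a left $\mathfrak R$-contramodule $\mathfrak P$, the contratensor product $\mathcal N\odot_{\mathfrak R}\mathfrak P$ is the cokernel of the difference of the two maps $\mathcal N\otimes_{\mathbb Z}\mathfrak R[[\mathfrak P]]\rightrightarrows\mathcal N\otimes_{\mathbb Z}\mathfrak P$ given by $\mathrm{id}\otimes\pi_{\mathfrak P}$ and by $b\otimes\sum_pr_pp\mapsto\sum_pbr_p\otimes p$. Its left derived functors, computed via projective resolutions of the contramodule argument, are denoted $\mathrm{Ctrtor}^{\mathfrak R}_i(\mathcal N,\mathfrak C)$. A left $\mathfrak R$-contramodule $\mathfrak F$ is $1$-strictly flat if $\mathrm{Ctrtor}^{\mathfrak R}_1(\mathcal N,\mathfrak F)=0$ for all discrete right $\mathfrak R$-modules $\mathcal N$. Direct limits are colimits indexed by directed posets. *)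

(* Defs.v *)
From HB Require Import structures.
From mathcomp Require Import all_boot all_order all_algebra finmap.
From mathcomp Require Import ring_quotient.
From mathcomp Require Import boolp classical_sets functions cardinality fsbigop.
From mathcomp Require Import filter topology normedtype summability.
From mathcomp Require Import freeg.

Set Implicit Arguments.
Unset Strict Implicit.
Unset Printing Implicit Defensive.

Import GRing.Theory.
Local Open Scope classical_set_scope.
Local Open Scope ring_scope.
Local Open Scope quotient_scope.

Section QuotLift.
Variables (A B : zmodType) (I : zmodClosed A) (f : {additive A -> B}).
Hypothesis fI : forall x, x \in I -> f x = 0.

Definition quot_lift of (forall x, x \in I -> f x = 0) : {ideal_quot I} -> B :=
  fun q => f (repr q).

Lemma quot_liftE x : quot_lift fI (\pi_{ideal_quot I} x) = f x.
Proof.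
apply/eqP; rewrite -subr_eq0 -raddfB fI // Quotient.idealrBE.
by rewrite reprK.
Qed.

Lemma quot_lift_zmod_morphism : zmod_morphism (quot_lift fI).
Proof.
move=> x y; rewrite -[x]reprK -[y]reprK.
by rewrite -raddfB !quot_liftE raddfB.
Qed.

HB.instance Definition _ :=
  GRing.isZmodMorphism.Build {ideal_quot I} B (quot_lift fI) quot_lift_zmod_morphism.
End QuotLift.

Lemma pi_quot_eq0 (A : zmodType) (I : zmodClosed A) (x : A) :
  (\pi_{ideal_quot I} x == 0 :> {ideal_quot I}) = (x \in I).
Proof.
by rewrite -[x in RHS]subr0 Quotient.idealrBE [\pi_{ideal_quot I} 0]raddf0.
Qed.

Section Image.
Variables (A B : zmodType) (f : {additive A -> B}).

Definition im_pred : {pred B} := fun b => `[< range f b >].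

Lemma im_pred_zmod_closed : zmod_closed im_pred.
Proof.
split; first by apply/asboolP; exists 0; rewrite ?raddf0.
move=> u v /asboolP[x _ <-] /asboolP[y _ <-]; apply/asboolP.
by exists (x - y); rewrite ?raddfB.
Qed.
HB.instance Definition _ :=
  GRing.isZmodClosed.Build B im_pred im_pred_zmod_closed.

End Image.

Definition coker (A B : zmodType) (f : {additive A -> B}) : zmodType :=
  {ideal_quot (im_pred f)}.

Definition coker_proj (A B : zmodType) (f : {additive A -> B}) : B -> coker f :=
  \pi_{ideal_quot (im_pred f)}.

HB.instance Definition _ A B f :=
  GRing.Additive.copy (@coker_proj A B f) (\pi_{ideal_quot (im_pred f)}).

(* A commutative square [v \o f = g \o u] induces [coker f -> coker g]. *)
Section CokerMap.
Variables (A B A' B' : zmodType).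
Variables (f : {additive A -> B}) (g : {additive A' -> B'}).
Variables (u : {additive A -> A'}) (v : {additive B -> B'}).
Hypothesis sq : v \o f =1 g \o u.

Lemma coker_map_subproof b : b \in im_pred f -> (coker_proj g \o v) b = 0.
Proof.
move=> /asboolP[a _ <-] /=; rewrite [v _]sq; apply/eqP; rewrite pi_quot_eq0.
by apply/asboolP; exists (u a).
Qed.

Definition coker_map : coker f -> coker g := quot_lift coker_map_subproof.
HB.instance Definition _ :=
  GRing.Additive.copy coker_map (quot_lift coker_map_subproof).
End CokerMap.

Section Homology.
Variables (A B C : zmodType) (f : {additive A -> B}) (g : {additive B -> C}).

Definition ker_pred : {pred B} := fun b => g b == 0.

Lemma ker_pred_zmod_closed : zmod_closed ker_pred.
Proof.
split; first by rewrite unfold_in raddf0.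
by move=> x y; rewrite !unfold_in raddfB => /eqP -> /eqP ->; rewrite subr0.
Qed.
HB.instance Definition _ :=
  GRing.isZmodClosed.Build B ker_pred ker_pred_zmod_closed.

Record ker : Type := Ker { ker_val :> B; ker_valP : ker_val \in ker_pred }.
HB.instance Definition _ := [isSub for ker_val].
HB.instance Definition _ := [Choice of ker by <:].
HB.instance Definition _ := [SubChoice_isSubZmodule of ker by <:].

Definition bound_pred : {pred ker} := fun z => val z \in im_pred f.

Lemma bound_pred_zmod_closed : zmod_closed bound_pred.
Proof.
split=> [|x y xb yb]; first by rewrite /bound_pred unfold_in raddf0 [_ \in _]rpred0.
have -> : (x - y \in bound_pred) = (val x - val y \in im_pred f).
  by rewrite -raddfB.
exact: rpredB.
Qed.
HB.instance Definition _ :=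
  GRing.isZmodClosed.Build ker bound_pred bound_pred_zmod_closed.

(* ker g / im f, meaningful when [g \o f] vanishes. *)
Definition homology : zmodType := {ideal_quot bound_pred}.
End Homology.

Section GeneratedSubgroup.
Variables (A : zmodType) (S : set A).

Definition is_subgroup (H : set A) : Prop :=
  H 0 /\ forall x y, H x -> H y -> H (x - y).

Definition gen_pred : {pred A} := fun x => `[< smallest is_subgroup S x >].

Lemma gen_pred_zmod_closed : zmod_closed gen_pred.
Proof.
split; first by apply/asboolP => H [[]].
move=> u v /asboolP uS /asboolP vS; apply/asboolP => H [gH SH].
by apply: gH.2; [exact: uS|exact: vS].
Qed.
HB.instance Definition _ :=
  GRing.isZmodClosed.Build A gen_pred gen_pred_zmod_closed.
End GeneratedSubgroup.

Section FreeLift.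
Variables (K : choiceType) (M : zmodType) (f : K -> M).

Definition free_lift : {freeg K} -> M := fglift (f : K -> zmodule M).

Lemma free_lift_zmod_morphism : zmod_morphism free_lift.
Proof. exact: (lift_is_additive (f : K -> zmodule M)). Qed.
HB.instance Definition _ := GRing.isZmodMorphism.Build {freeg K} M free_lift
  free_lift_zmod_morphism.

Lemma free_liftU k : free_lift << k >> = f k.
Proof. by rewrite /free_lift liftU scale1r. Qed.
End FreeLift.

Record biadditive (A B M : zmodType) := Biadditive {
  biadd_fun :> A -> B -> M;
  biaddDl : forall a a' b, biadd_fun (a + a') b = biadd_fun a b + biadd_fun a' b;
  biaddDr : forall a b b', biadd_fun a (b + b') = biadd_fun a b + biadd_fun a b'
}.

Section Tensor.
Variables A B : zmodType.

Definition tens_rel : set {freeg (A * B)} := [set t |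
  (exists (a a' : A) (b : B),
      t = << (a + a', b) >> - << (a, b) >> - << (a', b) >>) \/
  (exists (a : A) (b b' : B),
      t = << (a, b + b') >> - << (a, b) >> - << (a, b') >>)].

Definition tens : zmodType := {ideal_quot (gen_pred tens_rel)}.

Definition tens_pure (a : A) (b : B) : tens :=
  \pi_{ideal_quot (gen_pred tens_rel)} << (a, b) >>.

Lemma tens_rel0 t : tens_rel t ->
  \pi_{ideal_quot (gen_pred tens_rel)} t = 0 :> tens.
Proof.
move=> tS; apply/eqP; rewrite pi_quot_eq0; apply/asboolP.
exact: sub_gen_smallest.
Qed.

Lemma tens_pureDl a a' b :
  tens_pure (a + a') b = tens_pure a b + tens_pure a' b.
Proof.
apply/eqP; rewrite -subr_eq0 opprD addrA -!raddfB.
by apply/eqP/tens_rel0; left; exists a, a', b.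
Qed.

Lemma tens_pureDr a b b' :
  tens_pure a (b + b') = tens_pure a b + tens_pure a b'.
Proof.
apply/eqP; rewrite -subr_eq0 opprD addrA -!raddfB.
by apply/eqP/tens_rel0; right; exists a, b, b'.
Qed.

Lemma tens_pure0 b : tens_pure 0 b = 0.
Proof. by apply: (addIr (tens_pure 0 b)); rewrite -tens_pureDl !add0r. Qed.

Section Lift.
Variables (M : zmodType) (f : biadditive A B M).

Lemma tens_lift_subproof t : t \in gen_pred tens_rel ->
  free_lift (fun ab : A * B => f ab.1 ab.2) t = 0.
Proof.
set F := fun ab : A * B => _.
move=> /asboolP; apply: (smallest_sub (X := [set t | free_lift F t = 0])).
  split; first by rewrite /= raddf0.
  by move=> x y /= gx gy; rewrite raddfB /= gx gy subr0.
move=> _ [[a [a' [b ->]]]|[a [b [b' ->]]]] /=; rewrite !raddfB /= !free_liftU /F /=.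
  by rewrite biaddDl addrAC addrK subrr.
by rewrite biaddDr addrAC addrK subrr.
Qed.

Definition tens_lift : tens -> M := quot_lift tens_lift_subproof.
HB.instance Definition _ :=
  GRing.Additive.copy tens_lift (quot_lift tens_lift_subproof).

Lemma tens_liftE a b : tens_lift (tens_pure a b) = f a b.
Proof. by rewrite /tens_lift quot_liftE /= free_liftU. Qed.
End Lift.

Lemma tens_ext (M : zmodType) (u v : {additive tens -> M}) :
  (forall a b, u (tens_pure a b) = v (tens_pure a b)) -> u =1 v.
Proof.
move=> uv t; rewrite -[t]reprK; set x := repr t.
rewrite -(freeg_sumE x) !raddf_sum; apply: eq_bigr => -[a b] _.
have -> : << coeff (a, b) x *g (a, b) >> = << (a, b) >> *~ coeff (a, b) x.
  by rewrite freegU_mulz intz.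
by rewrite !raddfMz uv.
Qed.
End Tensor.

Section TensorMap.
Variables (A B B' : zmodType) (f : {additive B -> B'}).

Lemma tens_map_Dl (a a' : A) b :
  tens_pure (a + a') (f b) = tens_pure a (f b) + tens_pure a' (f b).
Proof. exact: tens_pureDl. Qed.

Lemma tens_map_Dr (a : A) b b' :
  tens_pure a (f (b + b')) = tens_pure a (f b) + tens_pure a (f b').
Proof. by rewrite raddfD tens_pureDr. Qed.

Definition tens_map : tens A B -> tens A B' :=
  tens_lift (Biadditive tens_map_Dl tens_map_Dr).
HB.instance Definition _ :=
  GRing.Additive.copy tens_map (tens_lift (Biadditive tens_map_Dl tens_map_Dr)).

Lemma tens_mapE a b : tens_map (tens_pure a b) = tens_pure a (f b).
Proof. exact: tens_liftE. Qed.
End TensorMap.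

HB.mixin Record TopologicalZmodule_isTopRing R
    & TopologicalZmodule R & GRing.PzRing R := {
  mul_continuous : continuous (fun x : R * R => x.1 * x.2)
}.

#[short(type="topRingType")]
HB.structure Definition TopRing :=
  {R of TopologicalZmodule R & GRing.PzRing R & TopologicalZmodule_isTopRing R}.

Section RightLinear.
Variable R : topRingType.

Definition right_ideal (I : set R) : Prop :=
  is_subgroup I /\ forall x r, I x -> I (x * r).

Definition open_right_ideal (I : set R) : Prop := open I /\ right_ideal I.

Definition right_linear : Prop := forall U : set R, nbhs 0 U ->
  exists2 I, open_right_ideal I & I `<=` U.

(* Injectivity, resp. surjectivity, of the map from [R] to the projective limit
   of the quotients [R / I]; an element of the limit is given by
   representatives [a I] of its components. *)
Definition separated : Prop := forall r : R,
  (forall I, open_right_ideal I -> I r) -> r = 0.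

Definition complete_ring : Prop := forall a : set R -> R,
  (forall I J, open_right_ideal I -> open_right_ideal J -> I `<=` J ->
     J (a I - a J)) ->
  exists r : R, forall I, open_right_ideal I -> I (r - a I).
End RightLinear.

HB.mixin Record TopRing_isCompleteRightLinear R & TopRing R := {
  right_linearP : right_linear R;
  separatedP : separated R;
  complete_ringP : complete_ring R
}.

#[short(type="crlTopRingType")]
HB.structure Definition CRLTopRing :=
  {R of TopRing R & TopRing_isCompleteRightLinear R}.

Section Sums.
Variable R : crlTopRingType.
Implicit Types (I J : set R) (X : choiceType).

Section Family.
Variable X : choiceType.

Definition null_pred : {pred (X -> R)} := fun r =>
  `[< forall I, open_right_ideal I -> finite_set [set x | ~ I (r x)] >].

Lemma null_pred_zmod_closed : zmod_closed null_pred.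
Proof.
split=> [|r s /asboolP rP /asboolP sP]; apply/asboolP => I oI.
  rewrite (_ : [set _ | _] = set0) //; apply/seteqP; split => // x /=.
  by case: oI => _ [[I0 _] _]; apply.
have: finite_set ([set x | ~ I (r x)] `|` [set x | ~ I (s x)]).
  by rewrite finite_setU; split; [exact: rP|exact: sP].
apply: sub_finite_set => x /= Irs; apply/not_andP => -[Ir Is]; apply: Irs.
by case: oI => _ [[_ IB] _]; apply: IB.
Qed.
HB.instance Definition _ :=
  GRing.isZmodClosed.Build (X -> R) null_pred null_pred_zmod_closed.

(* The limit of the finite partial sums; [0] by convention if there is none. *)
Definition tsum (r : X -> R) : R :=
  xget 0 [set s | partial_sum r @ totally --> s].
End Family.

Lemma open_rideal0 I : open_right_ideal I -> I 0.
Proof. by case=> _ [[]]. Qed.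

Lemma open_ridealB I x y : open_right_ideal I -> I x -> I y -> I (x - y).
Proof. by case=> _ [[_ IB] _]; exact: IB. Qed.

Lemma open_ridealN I x : open_right_ideal I -> I x -> I (- x).
Proof. by move=> oI Ix; rewrite -sub0r; apply: open_ridealB => //; exact: open_rideal0. Qed.

Lemma open_ridealD I x y : open_right_ideal I -> I x -> I y -> I (x + y).
Proof. by move=> oI Ix Iy; rewrite -[y]opprK; apply: open_ridealB => //; exact: open_ridealN. Qed.

Lemma open_rideal_sum I (T : Type) (s : seq T) (P : pred T) (F : T -> R) :
  open_right_ideal I -> (forall i, P i -> I (F i)) -> I (\sum_(i <- s | P i) F i).
Proof.
move=> oI IF; elim/big_ind: _ => //; first exact: open_rideal0.
by move=> x y; exact: open_ridealD.
Qed.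

Lemma open_rideal_sumD I (X : choiceType) (r : X -> R) (A B : {fset X}) :
    open_right_ideal I -> (A `<=` B)%fset ->
    (forall x, x \notin A -> I (r x)) ->
  I (\sum_(x <- B) r x - \sum_(x <- A) r x).
Proof.
move=> oI AB Ir; rewrite (big_fsetID _ (mem A) B) /=.
have -> : [fset x in B | x \in A]%fset = A.
  apply/fsetP => x; rewrite !inE /= andbC.
  by case xA: (x \in A) => //=; move/fsubsetP: AB => ->.
rewrite addrAC subrr add0r big_seq_cond; apply: open_rideal_sum => // x.
by rewrite !inE /= => /andP[/andP[_ xA] _]; exact: Ir.
Qed.

Lemma partial_sumE (X : choiceType) (r : X -> R) (A : {fset X}) :
  partial_sum r A = \sum_(x <- A) r x.
Proof. by rewrite /partial_sum big_seq_fsetE. Qed.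

Lemma nbhs_coset I (x : R) : open_right_ideal I -> nbhs x [set y | I (y - x)].
Proof.
move=> oI; have := @sub_continuous R (x, x) I; rewrite /= subrr => /(_ _).
have nI : nbhs (0 : R) I.
  by apply: open_nbhs_nbhs; split; [case: oI|exact: open_rideal0].
move=> /(_ nI) [[U V] [/= xU xV] UV]; apply: filterS xU => y Uy /=.
by apply: (UV (y, x)); split => //=; exact: nbhs_singleton.
Qed.

Lemma coset_nbhs (x : R) (U : set R) : nbhs x U ->
  exists2 I, open_right_ideal I & forall y, I (y - x) -> U y.
Proof.
move=> xU; have := @add_continuous R (0, x) U; rewrite /= add0r => /(_ xU).
move=> [[V W] [/= V0 Wx] VW]; have [I oI IV] := right_linearP _ V0.
exists I => // y Iyx; rewrite -(subrK x y); apply: (VW (_, _)); split => /=.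
  exact: IV.
exact: nbhs_singleton.
Qed.

Lemma tsum_cvg (X : choiceType) (r : X -> R) : r \in @null_pred X ->
  partial_sum r @ totally --> tsum r.
Proof.
move=> /asboolP rP; suff: exists s : R, partial_sum r @ totally --> s.
  exact: (@xgetPex _ 0 [set s | partial_sum r @ totally --> s]).
pose S I : {fset X} := fset_set [set x | ~ I (r x)].
have SI I x : open_right_ideal I -> x \notin S I -> I (r x).
  move=> oI; rewrite /S in_fset_set; last exact: rP.
  by rewrite notin_setE /= => /contrapT.
have [|s sP] := @complete_ringP R (fun I => \sum_(x <- S I) r x).
  move=> I J oI oJ IJ; apply: open_rideal_sumD => // [|x]; last exact: SI.
  apply/fsubsetP => x; rewrite /S !in_fset_set; [|exact: rP|exact: rP].
  by rewrite !inE /= => nJ /IJ.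
exists s => U /coset_nbhs[I oI IU]; exists (S I) => // A /= SA.
apply: IU; rewrite partial_sumE -(subrKA (\sum_(x <- S I) r x)).
rewrite -[X in _ + X]opprB; apply: open_ridealB => //; last exact: sP.
by apply: open_rideal_sumD => // x; exact: SI.
Qed.

Lemma tsumP (X : choiceType) (r : X -> R) I (A : {fset X}) :
    r \in @null_pred X -> open_right_ideal I ->
    (forall x, x \notin A -> I (r x)) ->
  I (tsum r - \sum_(x <- A) r x).
Proof.
move=> rP oI Ir; have [B _ BP] := tsum_cvg rP (nbhs_coset (tsum r) oI).
have := BP (A `|` B)%fset (fsubsetUr _ _); rewrite /= partial_sumE => IAB.
rewrite -(subrKA (\sum_(x <- (A `|` B)%fset) r x)); apply: open_ridealD => //.
  by rewrite -opprB; exact: open_ridealN.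
by apply: open_rideal_sumD => //; exact: fsubsetUl.
Qed.

Lemma null_subset (X Y : choiceType) (r : X -> R) (s : Y -> R) (f : X -> Y) :
    r \in @null_pred X ->
    (forall I y, open_right_ideal I -> (forall x, f x = y -> I (r x)) -> I (s y)) ->
  s \in @null_pred Y.
Proof.
move=> /asboolP rP sP; apply/asboolP => I oI.
apply: sub_finite_set (finite_image f (rP I oI)) => y /= nIs.
apply: contrapT => nex; apply: nIs; apply: sP => // x fx.
by apply: contrapT => nIr; apply: nex; exists x.
Qed.

Lemma sub_null (X : choiceType) (r s : X -> R) : r \in @null_pred X ->
  (forall I x, open_right_ideal I -> I (r x) -> I (s x)) -> s \in @null_pred X.
Proof.
move=> rP rs; apply: (null_subset (f := id) rP) => I x oI /(_ x erefl).
exact: rs.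
Qed.

Lemma tsum_in (X : choiceType) (r : X -> R) I : r \in @null_pred X ->
  open_right_ideal I -> (forall x, I (r x)) -> I (tsum r).
Proof.
move=> rP oI Ir; have := @tsumP X r I fset0 rP oI (fun x _ => Ir x).
by rewrite big_seq_fset0 subr0.
Qed.

Lemma null_support (X : choiceType) (r : X -> R) I : r \in @null_pred X ->
  open_right_ideal I -> exists A : {fset X}, forall x, x \notin A -> I (r x).
Proof.
move=> /asboolP/(_ I) + oI => /(_ oI) fI.
exists (fset_set [set x | ~ I (r x)]) => x.
by rewrite in_fset_set // notin_setE /= => /contrapT.
Qed.

Lemma tsum_fin (X : choiceType) (r : X -> R) (A : {fset X}) :
  (forall x, x \notin A -> r x = 0) -> tsum r = \sum_(x <- A) r x.
Proof.
move=> rA; have rP : r \in @null_pred X.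
  apply/asboolP => I oI; apply: sub_finite_set (finite_fset A) => x /= nI.
  by apply: contrapT => /negP/rA rx; apply: nI; rewrite rx; exact: open_rideal0.
apply/eqP; rewrite -subr_eq0; apply/eqP/separatedP => I oI.
by apply: tsumP => // x /rA ->; exact: open_rideal0.
Qed.

Lemma tsum_zmod (X : choiceType) (r s : X -> R) :
  r \in @null_pred X -> s \in @null_pred X ->
  tsum (r - s) = tsum r - tsum s.
Proof.
move=> rP sP; have rsP : r - s \in @null_pred X by exact: rpredB.
apply/eqP; rewrite -subr_eq0; apply/eqP/separatedP => I oI.
have [A rA] := null_support rP oI; have [B sB] := null_support sP oI.
pose C := (A `|` B)%fset.
have rC x : x \notin C -> I (r x) by rewrite inE negb_or => /andP[/rA].
have sC x : x \notin C -> I (s x) by rewrite inE negb_or => /andP[_ /sB].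
have rsC x : x \notin C -> I ((r - s) x).
  by move=> xC; apply: open_ridealB => //; [exact: rC|exact: sC].
have := tsumP rsP oI rsC; rewrite sumrB => h1.
have h2 := tsumP rP oI rC; have h3 := tsumP sP oI sC.
have := open_ridealB oI h1 (open_ridealB oI h2 h3).
set a := tsum (r - s); set b := tsum r; set c := tsum s.
set u := \sum_(i <- _) r _; set v := \sum_(i <- _) s _.
have -> : b - u - (c - v) = b - c - (u - v) by rewrite opprD addrACA -opprD.
by rewrite (opprB (b - c)) addrA subrK.
Qed.
End Sums.
Arguments null_pred {R X}.

Section FormalCombinations.
Variable R : crlTopRingType.

(* [fcomb X] is R[[X]]; choiceTypes play the role of sets. *)
Record fcomb (X : choiceType) : Type :=
  Fcomb { fcoef :> X -> R; fcoefP : fcoef \in null_pred }.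

HB.instance Definition _ X := [isSub for @fcoef X].
HB.instance Definition _ X := [Choice of fcomb X by <:].
HB.instance Definition _ X := [SubChoice_isSubZmodule of fcomb X by <:].

Lemma fcombP (X : choiceType) (c d : fcomb X) : c =1 d -> c = d.
Proof. by move=> cd; apply: val_inj; apply: funext. Qed.

Lemma fcombB (X : choiceType) (c d : fcomb X) x : (c - d) x = c x - d x.
Proof. by []. Qed.

Lemma fcombD (X : choiceType) (c d : fcomb X) x : (c + d) x = c x + d x.
Proof. by []. Qed.

Section Unit.
Variable X : choiceType.

Lemma funit_subproof (x : X) : (fun y => (y == x)%:R : R) \in null_pred.
Proof.
apply/asboolP => I oI; apply: sub_finite_set (finite_set1 x) => y /= nI.
by apply/eqP; apply: contra_notT nI => /negbTE ->; exact: open_rideal0.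
Qed.

Definition funit (x : X) : fcomb X := Fcomb (funit_subproof x).
End Unit.

Section Push.
Variables (X Y : choiceType) (f : X -> Y).

Lemma fiber_null (c : fcomb X) y :
  (fun x => if f x == y then c x else 0) \in null_pred.
Proof.
apply: (sub_null (fcoefP c)) => I x oI Ic.
by case: ifP => // _; exact: open_rideal0.
Qed.

Lemma push_subproof (c : fcomb X) :
  (fun y => tsum (fun x => if f x == y then c x else 0)) \in null_pred.
Proof.
apply: (null_subset (f := f) (fcoefP c)) => I y oI Ic.
apply: tsum_in => // [|x]; first exact: fiber_null.
by case: eqP => [/Ic//|_]; exact: open_rideal0.
Qed.

Definition push (c : fcomb X) : fcomb Y := Fcomb (push_subproof c).

Lemma push_zmod_morphism : zmod_morphism push.
Proof.
move=> c d; apply: fcombP => y; rewrite fcombB /=.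
rewrite -tsum_zmod; [|exact: fiber_null|exact: fiber_null].
congr tsum; apply: funext => x /=.
rewrite [in RHS]/GRing.add /= [in RHS]/GRing.opp /=.
by case: ifP => _; rewrite ?subrr.
Qed.
HB.instance Definition _ := GRing.isZmodMorphism.Build (fcomb X) (fcomb Y) push
  push_zmod_morphism.

Lemma push_unit x : push (funit x) = funit (f x).
Proof.
apply: fcombP => y /=; rewrite (@tsum_fin _ _ _ [fset x]%fset).
  by rewrite big_seq_fset1 eqxx eq_sym; case: eqP.
by move=> z; rewrite inE => /negbTE ->; rewrite if_same.
Qed.
End Push.

Section Flat.
Variable X : choiceType.

Lemma flat_summand_null (c : fcomb (fcomb X)) x :
  (fun a : fcomb X => c a * a x) \in null_pred.
Proof.
apply: (sub_null (fcoefP c)) => I a [_ [_ IM]]; exact: IM.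
Qed.

Lemma lmul_null (r : R) (a : fcomb X) : (fun x => r * a x) \in null_pred.
Proof.
apply/asboolP => I oI.
have := @mul_continuous R (r, 0) I; rewrite /= mulr0 => /(_ _).
have nI : nbhs (0 : R) I.
  by apply: open_nbhs_nbhs; split; [case: oI|exact: open_rideal0].
move=> /(_ nI) [[U V] [/= rU V0] UV]; have [J oJ JV] := right_linearP _ V0.
have /asboolP/(_ J oJ) := fcoefP a; apply: sub_finite_set => x /= nI' Ja.
by apply: nI'; apply: (UV (r, a x)); split => /=;
  [exact: nbhs_singleton|exact: JV].
Qed.

Lemma flat_subproof (c : fcomb (fcomb X)) :
  (fun x => tsum (fun a : fcomb X => c a * a x)) \in null_pred.
Proof.
apply/asboolP => I oI; have [A cA] := null_support (fcoefP c) oI.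
have fin : finite_set
    (\bigcup_(a in [set` A]) [set x | ~ I (c a * (a : fcomb X) x)]).
  apply: bigcup_finite => // a _.
  by have /asboolP/(_ I oI) := lmul_null (c a) a.
apply: sub_finite_set fin => x /= nI; apply: contrapT => nex; apply: nI.
apply: tsum_in => // [|a]; first exact: flat_summand_null.
have [aA|aA] := boolP (a \in A).
  by apply: contrapT => nI; apply: nex; exists a.
by case: (oI) => _ [_ IM]; apply: IM; exact: cA.
Qed.

(* The multiplication of the monad R[[-]] (opening of parentheses). *)
Definition flat (c : fcomb (fcomb X)) : fcomb X := Fcomb (flat_subproof c).

Lemma flat_zmod_morphism : zmod_morphism flat.
Proof.
move=> c d; apply: fcombP => x; rewrite fcombB /=.
rewrite -tsum_zmod; [|exact: flat_summand_null|exact: flat_summand_null].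
by congr tsum; apply: funext => a; exact: mulrBl.
Qed.
HB.instance Definition _ :=
  GRing.isZmodMorphism.Build (fcomb (fcomb X)) (fcomb X) flat
    flat_zmod_morphism.

Lemma flat_unit a : flat (funit a) = a.
Proof.
apply: fcombP => x /=; rewrite (@tsum_fin _ _ _ [fset a]%fset).
  by rewrite big_seq_fset1 eqxx mul1r.
by move=> z; rewrite inE => /negbTE ->; rewrite mul0r.
Qed.
End Flat.
End FormalCombinations.

HB.mixin Record isContramodule (R : crlTopRingType) C & Choice C := {
  contract : fcomb R C -> C;
  contract_assoc : forall c : fcomb R (fcomb R C),
    contract (push contract c) = contract (flat c);
  contract_unit : forall x : C, contract (funit R x) = x
}.

#[short(type="contramodType")]
HB.structure Definition Contramodule (R : crlTopRingType) :=
  {C of Choice C & isContramodule R C}.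

Section ContramoduleGroup.
Variables (R : crlTopRingType) (C : contramodType R).
Implicit Types x y z : C.
Local Notation act := (@contract R C).
Local Notation unit := (@funit R C).

(* The additive group structure of a contramodule is the one given by the
   contraactions of the finite combinations [0], [- 1 x] and [1 x + 1 y]. *)
Definition ct_zero : C := act 0.
Definition ct_opp x : C := act (- unit x).
Definition ct_add x y : C := act (unit x + unit y).

Lemma act_addE c d : act (c + d) = ct_add (act c) (act d).
Proof.
rewrite /ct_add -!(push_unit R act) -raddfD contract_assoc raddfD.
by rewrite /= !flat_unit.
Qed.

Lemma act_oppE c : act (- c) = ct_opp (act c).
Proof. by rewrite /ct_opp -(push_unit R act) -raddfN contract_assoc raddfN /= flat_unit. Qed.

Lemma ct_addA : associative ct_add.
Proof.
move=> x y z; rewrite -[x in LHS]contract_unit -[z in RHS]contract_unit.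
by rewrite -!act_addE addrA.
Qed.

Lemma ct_addC : commutative ct_add.
Proof. by move=> x y; rewrite /ct_add addrC. Qed.

Lemma ct_add0 : left_id ct_zero ct_add.
Proof. by move=> x; rewrite -[x in LHS]contract_unit -act_addE add0r contract_unit. Qed.

Lemma ct_addN : left_inverse ct_zero ct_opp ct_add.
Proof.
by move=> x; rewrite /ct_opp -[X in ct_add _ X]contract_unit -act_addE addNr.
Qed.

HB.instance Definition _ :=
  GRing.isZmodule.Build (C) ct_addA ct_addC ct_add0 ct_addN.
End ContramoduleGroup.

Section Contract.
Variables (R : crlTopRingType) (C : contramodType R).

Lemma contract_zmod_morphism : zmod_morphism (@contract R C).
Proof. by move=> c d; rewrite act_addE act_oppE. Qed.
HB.instance Definition _ :=
  GRing.isZmodMorphism.Build (fcomb R C) C (@contract R C)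
    contract_zmod_morphism.
End Contract.

Record contra_hom (R : crlTopRingType) (C D : contramodType R) := ContraHom {
  ch_fun :> C -> D;
  ch_contract : forall c : fcomb R C, ch_fun (contract c) = contract (push ch_fun c)
}.

Section HomAdditive.
Variables (R : crlTopRingType) (C D : contramodType R) (f : contra_hom C D).

Lemma ch_zmod_morphism : zmod_morphism f.
Proof.
move=> x y; rewrite -[x in LHS]contract_unit -[y in LHS]contract_unit -raddfB.
by rewrite ch_contract !raddfB /= !push_unit !contract_unit.
Qed.
HB.instance Definition _ := GRing.isZmodMorphism.Build C D f ch_zmod_morphism.
End HomAdditive.

(* The epimorphisms of contramodules are the surjective homomorphisms. *)
Definition projective (R : crlTopRingType) (P : contramodType R) : Prop :=
  forall (C D : contramodType R) (g : contra_hom C D) (f : contra_hom P D),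
    (forall y, exists x, g x = y) -> exists h : contra_hom P C, g \o h =1 f.

(* Right modules are left modules over the converse ring [R^c]. *)
Record discrete_rmodule (R : topRingType) := DiscreteRModule {
  dr_module :> lmodType R^c;
  dr_discrete : forall b : dr_module, open [set r : R | (r : R^c) *: b = 0]
}.

Definition ract (R : topRingType) (N : discrete_rmodule R) (b : N) (r : R) : N :=
  (r : R^c) *: b.

Section Contratensor.
Variables (R : crlTopRingType) (N : discrete_rmodule R).

Lemma ractDl (b b' : N) (r : R) : ract (b + b') r = ract b r + ract b' r.
Proof. exact: scalerDr. Qed.

Lemma ractDr (b : N) (r s : R) : ract b (r + s) = ract b r + ract b s.
Proof. exact: scalerDl. Qed.

Lemma ractBr (b : N) (r s : R) : ract b (r - s) = ract b r - ract b s.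
Proof. exact: scalerBl. Qed.

Lemma ract0 (b : N) : ract b 0 = 0.
Proof. exact: scale0r. Qed.

Lemma ractM (b : N) (r s : R) : ract b (r * s) = ract (ract b r) s.
Proof. by rewrite /ract scalerA. Qed.

Lemma ann_open_right_ideal (b : N) : open_right_ideal [set r | ract b r = 0].
Proof.
split; first exact: dr_discrete.
split=> [|r s /= br]; last by rewrite ractM br /ract scaler0.
split; first exact: ract0.
by move=> r s /= br bs; rewrite ractBr br bs subr0.
Qed.

Section CombTens.
Variable P : contramodType R.

(* The sum is finite: [b] is annihilated by all but finitely many [c p]. *)
Definition comb_tens (b : N) (c : fcomb R P) : tens N P :=
  \sum_(p \in [set: P]) tens_pure (ract b (c p)) p.

Lemma comb_tensE (b : N) (c : fcomb R P) (A : {fset P}) :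
    (forall p, p \notin A -> ract b (c p) = 0) ->
  comb_tens b c = \sum_(p <- A) tens_pure (ract b (c p)) p.
Proof. by move=> bc; apply: fsbigTE => p /bc ->; exact: tens_pure0. Qed.

Lemma comb_support (b : N) (c : fcomb R P) :
  exists A : {fset P}, forall p, p \notin A -> ract b (c p) = 0.
Proof. exact: null_support (fcoefP c) (ann_open_right_ideal b). Qed.

Lemma comb_tensDl (b b' : N) (c : fcomb R P) :
  comb_tens (b + b') c = comb_tens b c + comb_tens b' c.
Proof.
have [A bA] := comb_support b c; have [A' bA'] := comb_support b' c.
rewrite !(@comb_tensE _ _ (A `|` A')%fset).
- rewrite -big_split; apply: eq_bigr => p _ /=.
  by rewrite ractDl tens_pureDl.
- by move=> p; rewrite inE negb_or => /andP[_ /bA'].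
- by move=> p; rewrite inE negb_or => /andP[/bA].
- move=> p; rewrite inE negb_or ractDl => /andP[/bA -> /bA' ->].
  by rewrite addr0.
Qed.

Lemma comb_tensDr (b : N) (c c' : fcomb R P) :
  comb_tens b (c + c') = comb_tens b c + comb_tens b c'.
Proof.
have [A bA] := comb_support b c; have [A' bA'] := comb_support b c'.
rewrite !(@comb_tensE _ _ (A `|` A')%fset).
- rewrite -big_split; apply: eq_bigr => p _ /=.
  by rewrite -tens_pureDl -ractDr.
- by move=> p; rewrite inE negb_or => /andP[_ /bA'].
- by move=> p; rewrite inE negb_or => /andP[/bA].
- move=> p; rewrite inE negb_or fcombD ractDr => /andP[/bA -> /bA' ->].
  by rewrite addr0.
Qed.

Definition comb_tens_biadd := Biadditive comb_tensDl comb_tensDr.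

Definition ctens_diff (t : tens N (fcomb R P)) : tens N P :=
  tens_map (@contract R P) t - tens_lift comb_tens_biadd t.

Lemma ctens_diff_zmod_morphism : zmod_morphism ctens_diff.
Proof. by move=> x y; rewrite /ctens_diff !raddfB /= addrACA. Qed.
HB.instance Definition _ :=
  GRing.isZmodMorphism.Build (tens N (fcomb R P)) (tens N P) ctens_diff
    ctens_diff_zmod_morphism.

Definition contratensor : zmodType := coker ctens_diff.
End CombTens.

Section Functoriality.
Variables (P Q : contramodType R) (f : contra_hom P Q).

Lemma ract_tsum (b : N) (r : P -> R) (A : {fset P}) : r \in null_pred ->
    (forall p, p \notin A -> ract b (r p) = 0) ->
  ract b (tsum r) = \sum_(p <- A) ract b (r p).
Proof.
move=> rP bA; have := tsumP rP (ann_open_right_ideal b) bA.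
rewrite /= ractBr => /eqP; rewrite subr_eq0 => /eqP ->.
exact: (big_morph (ract b) (ractDr b) (ract0 b)).
Qed.

Lemma comb_tens_push (b : N) (c : fcomb R P) :
  tens_map f (comb_tens b c) = comb_tens b (push f c).
Proof.
have [A bA] := comb_support b c.
have bpush q : ract b (push f c q) =
    \sum_(p <- A) if f p == q then ract b (c p) else 0.
  rewrite /= (@ract_tsum _ _ A).
  - by apply: eq_bigr => p _; case: ifP => // _; exact: ract0.
  - exact: fiber_null.
  - by move=> p /bA bp; case: ifP => // _; exact: ract0.
rewrite (comb_tensE bA) raddf_sum.
rewrite (@comb_tensE _ _ _ (f @` A)%fset); last first.
  move=> q qA; rewrite bpush big_seq big1 // => p pA.
  by case: eqP => // fp; rewrite -fp in_imfset in qA.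
under [RHS]eq_bigr => q _.
  rewrite bpush.
  rewrite (big_morph (fun a => tens_pure a q) (fun a a' => tens_pureDl a a' q)
    (tens_pure0 _ q)).
  over.
rewrite exchange_big /= big_seq [RHS]big_seq; apply: eq_bigr => p pA.
rewrite tens_mapE (bigD1_seq (f p)) ?in_imfset ?fset_uniq //= eqxx.
rewrite big1 ?addr0 // => q; rewrite eq_sym => /negbTE ->.
exact: tens_pure0.
Qed.

Lemma contratensor_map_subproof :
  tens_map f \o @ctens_diff P =1 @ctens_diff Q \o tens_map (push f).
Proof.
move=> t; rewrite /= /ctens_diff raddfB /=; congr (_ - _).
  rewrite -[LHS]/((tens_map f \o tens_map contract) t).
  rewrite -[RHS]/((tens_map contract \o tens_map (push f)) t).
  by apply: tens_ext => a b /=; rewrite !tens_mapE /= ch_contract.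
rewrite -[LHS]/((tens_map f \o tens_lift (@comb_tens_biadd P)) t).
rewrite -[RHS]/((tens_lift (@comb_tens_biadd Q) \o tens_map (push f)) t).
by apply: tens_ext => a b /=; rewrite tens_mapE !tens_liftE /= comb_tens_push.
Qed.

Definition contratensor_map : contratensor P -> contratensor Q :=
  coker_map contratensor_map_subproof.
HB.instance Definition _ :=
  GRing.Additive.copy contratensor_map (coker_map contratensor_map_subproof).
End Functoriality.
End Contratensor.
Arguments contratensor_map {R} N {P Q} f.

(* The forgetful functor from contramodules to abelian groups is exact and
   faithful, so exactness is stated on elements. *)
Record proj_resolution (R : crlTopRingType) (C : contramodType R) :=
  ProjResolution {
    pr_obj :> nat -> contramodType R;
    pr_diff : forall n, contra_hom (pr_obj n.+1) (pr_obj n);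
    pr_aug : contra_hom (pr_obj 0) C;
    pr_projective : forall n, projective (pr_obj n);
    pr_aug_surj : forall x : C, exists y, pr_aug y = x;
    pr_exact0 : forall x : pr_obj 0,
      pr_aug x = 0 <-> exists y, pr_diff 0 y = x;
    pr_exact : forall n (x : pr_obj n.+1),
      pr_diff n x = 0 <-> exists y, pr_diff n.+1 y = x
  }.

Section Ctrtor.
Variables (R : crlTopRingType) (N : discrete_rmodule R) (C : contramodType R).
Variable P : proj_resolution C.

(* The differential of the complex [N (.) P] leaving degree [n]; the complex is
   zero in negative degrees. *)
Definition ctrtor_out (n : nat) :
    {additive contratensor N (P n) -> contratensor N (P n.-1)} :=
  match n with
  | 0 => \0
  | m.+1 => contratensor_map N (pr_diff P m)
  end.

(* [Ctrtor_n (N, C)] computed by the resolution [P] of [C]. *)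
Definition Ctrtor (n : nat) : zmodType :=
  homology (contratensor_map N (pr_diff P n)) (ctrtor_out n).
End Ctrtor.

(* The group [Ctrtor_1 (N, F)] is independent of the resolution up to
   isomorphism; its vanishing is required for every resolution. *)
Definition strictly_flat1 (R : crlTopRingType) (F : contramodType R) : Prop :=
  forall (N : discrete_rmodule R) (P : proj_resolution F) (x : Ctrtor N P 1),
    x = 0.

Definition directed (d : Order.disp_t) (I : porderType d) : Prop :=
  inhabited I /\ forall i j : I, exists k : I, (i <= k)%O /\ (j <= k)%O.

Section DirectLimit.
Variables (R : crlTopRingType) (d : Order.disp_t) (I : porderType d).

Record diagram := Diagram {
  dg_obj :> I -> contramodType R;
  dg_map : forall i j : I, (i <= j)%O -> contra_hom (dg_obj i) (dg_obj j);
  dg_id : forall i (ii : (i <= i)%O) x, dg_map ii x = x;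
  dg_comp : forall i j k (ij : (i <= j)%O) (jk : (j <= k)%O) (ik : (i <= k)%O) x,
    dg_map jk (dg_map ij x) = dg_map ik x
}.

Record cocone (F : diagram) (L : contramodType R) := Cocone {
  cc_leg :> forall i, contra_hom (F i) L;
  cc_compat : forall i j (ij : (i <= j)%O) x, cc_leg j (dg_map F ij x) = cc_leg i x
}.

Definition is_colimit (F : diagram) (L : contramodType R) (c : cocone F L) :=
  forall (M : contramodType R) (c' : cocone F M),
    exists2 h : contra_hom L M, (forall i, h \o c i =1 c' i) &
      forall h' : contra_hom L M, (forall i, h' \o c i =1 c' i) -> h' =1 h.
End DirectLimit.

(* Main.v *)
From HB Require Import structures.
From mathcomp Require Import all_boot all_order all_algebra finmap.
From mathcomp Require Import boolp classical_sets functions cardinality fsbigop.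
From mathcomp Require Import filter topology.
Require Import Defs.

Set Implicit Arguments.
Unset Strict Implicit.
Unset Printing Implicit Defensive.

Import GRing.Theory.
Local Open Scope classical_set_scope.
Local Open Scope ring_scope.
Local Open Scope quotient_scope.

(* For a projective resolution [P] of the colimit [L], with [K] the kernel of
   [P_0 -> L], vanishing of [Ctrtor_1(N, L)] means that [N (.) K -> N (.) P_0]
   is injective.  Let [E_i] be the pullback of [P_0 -> L] along [F_i -> L], so
   that [0 -> K -> E_i -> F_i -> 0] is exact.  As [F_i] is 1-strictly flat, every
   [N (.) K -> N (.) E_i] is injective, and direct limits of abelian groups are
   exact, so it is enough that [N (.) P_0] is the direct limit of the
   [N (.) E_i].  Since [N (.) -] is left adjoint to [Hom_Z(N, -)], this follows
   if [P_0] is the direct limit of the [E_i].  That holds although direct limits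
   of contramodules need not be exact: [K -> lim E_i -> L -> 0] is right exact,
   and [K -> lim E_i] is a monomorphism because its composition with
   [lim E_i -> P_0] is one. *)

(** * Formal linear combinations *)

Section Sums.
Variable R : crlTopRingType.

(** Separatedness reduces an identity between infinite sums to congruences modulo each open right
    ideal, where only finitely many terms matter. *)
Lemma eq_mod_open_ideals (x y : R) :
  (forall I, open_right_ideal I -> I (x - y)) -> x = y.
Proof. by move=> xy; apply/eqP; rewrite -subr_eq0; apply/eqP/separatedP. Qed.

Lemma nullP (X : choiceType) (r : X -> R) :
  (forall I, open_right_ideal I ->
    exists A : {fset X}, forall x, x \notin A -> I (r x)) ->
  r \in null_pred.
Proof.
move=> rP; apply/asboolP => I /[dup] oI /rP[A rA].
apply: sub_finite_set (finite_fset A) => x /= nI.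
by apply: contrapT => /negP/rA.
Qed.

Lemma null_mulr (X : choiceType) (r : X -> R) (s : R) :
  r \in null_pred -> (fun x => r x * s) \in null_pred.
Proof.
by move=> /sub_null; apply => I x [_ [_ IM]] /IM.
Qed.

Lemma null_mull (X : choiceType) (r : X -> R) (s : R) :
  r \in null_pred -> (fun x => s * r x) \in null_pred.
Proof. by move=> rP; exact: (lmul_null s (Fcomb rP)). Qed.

Lemma tsum_mulr (X : choiceType) (r : X -> R) (s : R) :
  r \in null_pred -> tsum (fun x => r x * s) = tsum r * s.
Proof.
move=> rP; apply: eq_mod_open_ideals => I oI.
have [A rA] := null_support rP oI; have IM := oI.2.2.
have h1 := tsumP (null_mulr s rP) oI (fun x xA => IM _ s (rA x xA)).
have h2 := IM _ s (tsumP rP oI rA).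
rewrite mulrBl mulr_suml in h2.
have := open_ridealB oI h1 h2.
by rewrite opprB addrA subrK.
Qed.

(** A right ideal need not absorb multiplication on the left; continuity of multiplication at
    [(s, 0)] supplies an open right ideal that [s] carries into [I]. *)
Lemma mull_open (s : R) I : open_right_ideal I ->
  exists2 J, open_right_ideal J & forall x, J x -> I (s * x).
Proof.
move=> oI; have := @mul_continuous R (s, 0) I; rewrite /= mulr0 => /(_ _).
have nI : nbhs (0 : R) I.
  by apply: open_nbhs_nbhs; split; [case: oI|exact: open_rideal0].
move=> /(_ nI) [[U V] [/= sU V0] UV]; have [J oJ JV] := right_linearP _ V0.
exists J => // x Jx; apply: (UV (s, x)); split => /=.
  exact: nbhs_singleton.
exact: JV.
Qed.

Lemma tsum_mull (X : choiceType) (r : X -> R) (s : R) :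
  r \in null_pred -> tsum (fun x => s * r x) = s * tsum r.
Proof.
move=> rP; apply: eq_mod_open_ideals => I oI.
have [J oJ JI] := mull_open s oI; have [A rA] := null_support rP oJ.
have [B sB] := null_support (null_mull s rP) oI.
have rAB x : x \notin (A `|` B)%fset -> J (r x).
  by rewrite inE negb_or => /andP[/rA].
have sAB x : x \notin (A `|` B)%fset -> I (s * r x).
  by rewrite inE negb_or => /andP[_ /sB].
have h1 := tsumP (null_mull s rP) oI sAB.
have h2 := JI _ (tsumP rP oJ rAB).
rewrite mulrBr mulr_sumr in h2.
have := open_ridealB oI h1 h2.
by rewrite opprB addrA subrK.
Qed.

Lemma null_row (X Y : choiceType) (w : X -> Y -> R) x :
  (fun p : X * Y => w p.1 p.2) \in null_pred -> w x \in null_pred.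
Proof.
move=> wP; apply: nullP => I oI; have [S wS] := null_support wP oI.
exists [fset p.2 | p in S]%fset => y yS; apply: (wS (x, y)).
by apply: contra yS => xyS; apply/imfsetP; exists (x, y).
Qed.

Lemma tsum_rows_null (X Y : choiceType) (w : X -> Y -> R) :
  (fun p : X * Y => w p.1 p.2) \in null_pred ->
  (fun x => tsum (w x)) \in null_pred.
Proof.
move=> wP; apply: nullP => I oI; have [S wS] := null_support wP oI.
exists [fset p.1 | p in S]%fset => x xS; apply: tsum_in => //.
  exact: null_row.
move=> y; apply: (wS (x, y)).
by apply: contra xS => xyS; apply/imfsetP; exists (x, y).
Qed.

Lemma tsum_rowsP (X Y : choiceType) (w : X -> Y -> R) I
    (A : {fset X}) (B : {fset Y}) :
  (fun p : X * Y => w p.1 p.2) \in null_pred -> open_right_ideal I ->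
  (forall x y, (x \notin A) || (y \notin B) -> I (w x y)) ->
  I (tsum (fun x => tsum (w x)) - \sum_(x <- A) \sum_(y <- B) w x y).
Proof.
move=> wP oI wI; rewrite -(subrKA (\sum_(x <- A) tsum (w x))).
apply: open_ridealD => //.
  apply: tsumP => //; first exact: tsum_rows_null.
  move=> x xA; apply: tsum_in => //; first exact: null_row.
  by move=> y; apply: wI; rewrite xA.
rewrite -sumrB; apply: open_rideal_sum => // x _.
apply: tsumP => //; first exact: null_row.
by move=> y yB; apply: wI; rewrite yB orbT.
Qed.

(** Joint nullness over pairs leaves, modulo [I], only the terms in a finite rectangle [A] by [B],
    where the order of summation is immaterial. *)
Lemma tsum_exchange (X Y : choiceType) (w : X -> Y -> R) :
  (fun p : X * Y => w p.1 p.2) \in null_pred ->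
  tsum (fun x => tsum (w x)) = tsum (fun y => tsum (w^~ y)).
Proof.
move=> wP; apply: eq_mod_open_ideals => I oI.
have [S wS] := null_support wP oI.
pose A := [fset p.1 | p in S]%fset; pose B := [fset p.2 | p in S]%fset.
have wI x y : (x \notin A) || (y \notin B) -> I (w x y).
  move=> xy; apply: (wS (x, y)); apply: contraL xy => xyS.
  by rewrite negb_or !negbK; apply/andP; split; apply/imfsetP; exists (x, y).
have wP' : (fun p : Y * X => w p.2 p.1) \in null_pred.
  apply: (null_subset (f := fun p : X * Y => (p.2, p.1)) wP) => J [y x] _.
  by move=> /(_ (x, y)); apply.
have h1 := tsum_rowsP wP oI wI.
have h2 : I (tsum (fun y => tsum (w^~ y)) - \sum_(y <- B) \sum_(x <- A) w x y).
  apply: (@tsum_rowsP _ _ (fun y x => w x y)) => // y x; rewrite orbC.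
  exact: wI.
rewrite exchange_big in h2.
have := open_ridealB oI h1 h2.
by rewrite opprB addrA subrK.
Qed.

(** The double family lives on the graph of [f], hence is null; after the exchange each inner sum
    has the single term at [f x]. *)
Lemma tsum_fiber (X Y : choiceType) (f : X -> Y) (r : X -> R) :
  r \in null_pred ->
  tsum (fun y => tsum (fun x => if f x == y then r x else 0)) = tsum r.
Proof.
move=> rP; rewrite -(@tsum_exchange _ _ (fun x y => if f x == y then r x else 0)).
  congr tsum; apply: funext => x; rewrite (@tsum_fin _ _ _ [fset f x]%fset).
    by rewrite big_seq_fset1 eqxx.
  by move=> y; rewrite inE eq_sym => /negbTE ->.
apply: (null_subset (f := fun x => (x, f x)) rP) => I [x y] oI /= h.
by case: eqP => [fx|_]; [apply: h; rewrite fx|exact: open_rideal0].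
Qed.

Lemma push_comp (X Y Z : choiceType) (f : X -> Y) (g : Y -> Z) (c : fcomb R X) :
  push g (push f c) = push (g \o f) c.
Proof.
apply: fcombP => z /=; rewrite -[RHS](tsum_fiber f); last exact: fiber_null.
congr tsum; apply: funext => y; case: (eqVneq (g y) z) => [gz|gz].
  congr tsum; apply: funext => x; case: (eqVneq (f x) y) => // ->.
  by rewrite gz eqxx.
rewrite (@tsum_fin _ _ _ fset0) ?big_seq_fset0// => x _.
by case: (eqVneq (f x) y) => // ->; rewrite (negbTE gz).
Qed.

Lemma eq_push (X Y : choiceType) (f g : X -> Y) (c : fcomb R X) :
  f =1 g -> push f c = push g c.
Proof. by move=> /funext ->. Qed.

Lemma push_id (X : choiceType) (c : fcomb R X) : push id c = c.
Proof.
apply: fcombP => x /=; rewrite (@tsum_fin _ _ _ [fset x]%fset).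
  by rewrite big_seq_fset1 eqxx.
by move=> y; rewrite inE => /negbTE ->.
Qed.

(** [push a c] merges the indices with equal [a x]; summing over the fibres of [a] undoes the
    merging. *)
Lemma flat_pushE (X Y : choiceType) (a : X -> fcomb R Y) (c : fcomb R X) y :
  flat (push a c) y = tsum (fun x => c x * a x y).
Proof.
have cP : (fun x => c x * a x y) \in null_pred.
  by apply: (sub_null (fcoefP c)) => I x [_ [_ IM]] /IM.
rewrite /= -[RHS](tsum_fiber a)//; congr tsum; apply: funext => d.
rewrite -tsum_mulr; last exact: fiber_null.
congr tsum; apply: funext => x; case: eqP => [->//|_].
by rewrite mul0r.
Qed.

(* Associativity of the monad in its Kleisli form. *)
Lemma flat_push_assoc (X Y Z : choiceType) (a : X -> fcomb R Y)
    (b : Y -> fcomb R Z) (c : fcomb R X) :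
  flat (push b (flat (push a c))) = flat (push (fun x => flat (push b (a x))) c).
Proof.
apply: fcombP => z; rewrite !flat_pushE.
have aP x : (fun y => a x y * b y z) \in null_pred.
  by apply: (sub_null (fcoefP (a x))) => I y [_ [_ IM]] /IM.
under [in RHS]eq_fun do rewrite flat_pushE -tsum_mull//.
under [in LHS]eq_fun => y.
  rewrite flat_pushE -tsum_mulr; last first.
    by apply: (sub_null (fcoefP c)) => I x [_ [_ IM]] /IM.
  under eq_fun do rewrite -mulrA.
  over.
rewrite (@tsum_exchange _ _ (fun y x => c x * (a x y * b y z)))//.
(* Outside the finite set [A] the factor [c x] lies in [I], which absorbs the rest; each of the
   finitely many [x] in [A] contributes its own finite set [B x]. *)
apply: nullP => I oI; have [A cA] := null_support (fcoefP c) oI.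
have B x : {B : {fset Y} | forall y, y \notin B -> I (c x * (a x y * b y z))}.
  by apply: cid; apply: null_support oI; exact: null_mull.
pose S : {fset Y} := [fset y | x in A, y in sval (B x)]%fset.
exists (S `*` A)%fset => -[y x] /=.
rewrite in_fsetM /= negb_and; have [xA|xA _] := boolP (x \in A).
  rewrite orbF => yS; apply: (svalP (B x)); apply: contra yS => yB.
  by apply/imfset2P; exists x => //; exists y.
by case: (oI) => _ [_ IM]; apply/IM/cA.
Qed.

(** With [push] written as a Kleisli extension, naturality of [flat] becomes an instance of
    [flat_push_assoc]. *)
Lemma flat_push_unit (X Y : choiceType) (f : X -> Y) (c : fcomb R X) :
  flat (push (fun x => funit R (f x)) c) = push f c.
Proof.
apply: fcombP => y; rewrite flat_pushE /=; congr tsum; apply: funext => x.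
by rewrite eq_sym; case: eqP => _; rewrite ?mulr1 ?mulr0.
Qed.

Lemma flat_push_push (X Y : choiceType) (f : X -> Y) (c : fcomb R (fcomb R X)) :
  flat (push (push f) c) = push f (flat c).
Proof.
rewrite -[RHS]flat_push_unit -[c in RHS]push_id flat_push_assoc.
by congr flat; apply: eq_push => a; rewrite flat_push_unit.
Qed.

Lemma flat_flat (X : choiceType) (c : fcomb R (fcomb R (fcomb R X))) :
  flat (push (@flat R X) c) = flat (flat c).
Proof.
rewrite -[flat c]push_id -[c in RHS]push_id flat_push_assoc.
by congr flat; apply: eq_push => a; rewrite push_id.
Qed.
End Sums.

(** * Constructions of contramodules *)

Section Homs.
Variable R : crlTopRingType.
Implicit Types C D E : contramodType R.

Lemma contractB C (c d : fcomb R C) :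
  contract (c - d) = contract c - contract d.
Proof. exact: raddfB. Qed.

(** Contraassociativity for an indexed family of combinations, the form used for the structures
    below. *)
Lemma contract_push_contract C (X : choiceType) (a : X -> fcomb R C)
    (c : fcomb R X) :
  contract (push (fun x => contract (a x)) c) = contract (flat (push a c)).
Proof. by rewrite -contract_assoc push_comp. Qed.

Lemma ch_id_subproof C (c : fcomb R C) : contract c = contract (push id c).
Proof. by rewrite push_id. Qed.

Definition ch_id C : contra_hom C C := ContraHom (@ch_id_subproof C).

Lemma ch_comp_subproof C D E (g : contra_hom D E) (f : contra_hom C D)
    (c : fcomb R C) :
  (g \o f) (contract c) = contract (push (g \o f) c).
Proof. by rewrite /= !ch_contract push_comp. Qed.

Definition ch_comp C D E (g : contra_hom D E) (f : contra_hom C D) :=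
  ContraHom (ch_comp_subproof g f).

Lemma ch_zero_subproof C D (c : fcomb R C) :
  0 = contract (push (fun=> 0 : D) c).
Proof.
transitivity (contract (push (fun _ : C => contract (0 : fcomb R D)) c)).
  rewrite contract_push_contract.
  suff -> : flat (push (fun=> 0) c) = 0 :> fcomb R D by rewrite raddf0.
  apply: fcombP => y; rewrite flat_pushE /=.
  rewrite (@tsum_fin _ _ _ fset0) ?big_seq_fset0// => x _.
  exact: mulr0.
by rewrite raddf0.
Qed.

Definition ch_zero C D : contra_hom C D := ContraHom (@ch_zero_subproof C D).

End Homs.

(** * Free contramodules *)

Section Free.
Variable R : crlTopRingType.

Definition free_contra (X : choiceType) : Type := fcomb R X.

HB.instance Definition _ X := Choice.copy (free_contra X) (fcomb R X).
HB.instance Definition _ X := isContramodule.Build R (free_contra X)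
  (@flat_flat R X) (@flat_unit R X).

Lemma free_extend_subproof (X : choiceType) (C : contramodType R) (f : X -> C)
    (c : fcomb R (free_contra X)) :
  contract (push f (flat c : free_contra X)) =
  contract (push (fun a : free_contra X => contract (push f a)) c).
Proof. by rewrite contract_push_contract flat_push_push. Qed.

Definition free_extend (X : choiceType) (C : contramodType R) (f : X -> C) :
  contra_hom (free_contra X) C := ContraHom (free_extend_subproof f).

Lemma free_extendU (X : choiceType) (C : contramodType R) (f : X -> C) x :
  free_extend f (funit R x) = f x.
Proof. by rewrite /= push_unit contract_unit. Qed.

(** The lift is determined by chosen preimages of the images of the units. *)
Lemma free_projective X : projective (free_contra X).
Proof.
move=> C D g f gs; pose h x := sval (cid (gs (f (funit R x)))).
have gh x : g (h x) = f (funit R x) := svalP (cid (gs (f (funit R x)))).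
exists (free_extend h) => a /=; rewrite ch_contract push_comp.
rewrite (eq_push (g := f \o @funit R X))// -push_comp -ch_contract.
(* [a] is the contraaction of the combination of units with the same coefficients. *)
congr (f _); rewrite /contract /= -[RHS](push_id a); exact: flat_push_unit.
Qed.
End Free.

(** * Equalizers and products *)

Section Equalizer.
Variables (R : crlTopRingType) (X Y : contramodType R) (f g : contra_hom X Y).

Record equalizer := Equalizer { eqz_val : X; eqz_valP : f eqz_val == g eqz_val }.
HB.instance Definition _ := [isSub for eqz_val].
HB.instance Definition _ := [Choice of equalizer by <:].

Lemma eqz_contract_subproof (c : fcomb R equalizer) :
  f (contract (push eqz_val c)) == g (contract (push eqz_val c)).
Proof.
rewrite !ch_contract !push_comp; apply/eqP; congr contract.
by apply: eq_push => x; apply/eqP; exact: eqz_valP.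
Qed.

Definition eqz_contract (c : fcomb R equalizer) :=
  Equalizer (eqz_contract_subproof c).

Lemma eqz_contract_assoc (c : fcomb R (fcomb R equalizer)) :
  eqz_contract (push eqz_contract c) = eqz_contract (flat c).
Proof.
apply: val_inj => /=; rewrite push_comp -flat_push_push -contract_push_contract.
by [].
Qed.

Lemma eqz_contract_unit x : eqz_contract (funit R x) = x.
Proof. by apply: val_inj; rewrite /= push_unit contract_unit. Qed.

HB.instance Definition _ :=
  isContramodule.Build R equalizer eqz_contract_assoc eqz_contract_unit.

Definition eqz_incl : contra_hom equalizer X :=
  @ContraHom R equalizer X eqz_val (fun=> erefl).

Lemma eqz_inclP x : f (eqz_incl x) = g (eqz_incl x).
Proof. by apply/eqP; exact: eqz_valP. Qed.

Lemma eqz_incl_inj : injective eqz_incl.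
Proof. exact: val_inj. Qed.

Section Lift.
Variables (Z : contramodType R) (h : contra_hom Z X).
Hypothesis fgh : forall z, f (h z) = g (h z).

Definition eqz_lift_fun z := Equalizer (introT eqP (fgh z)).

Lemma eqz_lift_subproof (c : fcomb R Z) :
  eqz_lift_fun (contract c) = contract (push eqz_lift_fun c).
Proof. by apply: eqz_incl_inj; rewrite ch_contract push_comp /= ch_contract. Qed.

Definition eqz_lift : contra_hom Z equalizer := ContraHom eqz_lift_subproof.
End Lift.
End Equalizer.

Section Product.
Variables (R : crlTopRingType) (C D : contramodType R).

Definition prod_contra : Type := C * D.
HB.instance Definition _ := Choice.copy prod_contra (C * D)%type.

Definition prod_contract (c : fcomb R prod_contra) : prod_contra :=
  (contract (push fst c), contract (push snd c)).

Lemma prod_contract_assoc (c : fcomb R (fcomb R prod_contra)) :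
  prod_contract (push prod_contract c) = prod_contract (flat c).
Proof.
rewrite /prod_contract !push_comp -!flat_push_push.
rewrite -(contract_push_contract (push fst)).
by rewrite -(contract_push_contract (push snd)).
Qed.

Lemma prod_contract_unit x : prod_contract (funit R x) = x.
Proof. by case: x => x y; rewrite /prod_contract !push_unit !contract_unit. Qed.

HB.instance Definition _ :=
  isContramodule.Build R prod_contra prod_contract_assoc prod_contract_unit.

Definition pfst : contra_hom prod_contra C :=
  @ContraHom R prod_contra C fst (fun=> erefl).
Definition psnd : contra_hom prod_contra D :=
  @ContraHom R prod_contra D snd (fun=> erefl).

Lemma pair_subproof (Z : contramodType R) (f : contra_hom Z C)
    (g : contra_hom Z D) (c : fcomb R Z) :
  (f (contract c), g (contract c)) =
  contract (push (fun z => (f z, g z) : prod_contra) c).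
Proof. by rewrite /contract /= /prod_contract !push_comp !ch_contract. Qed.

Definition ch_pair (Z : contramodType R) (f : contra_hom Z C)
    (g : contra_hom Z D) : contra_hom Z prod_contra :=
  @ContraHom R Z prod_contra (fun z => (f z, g z)) (pair_subproof f g).
End Product.

(** * Factorization through surjections, and cokernels *)

Section Factor.
Variables (R : crlTopRingType) (C D E : contramodType R).
Variables (p : contra_hom C D) (f : contra_hom C E).
Hypothesis p_surj : forall y, exists x, p x = y.
Hypothesis pf : forall x, p x = 0 -> f x = 0.

Definition factor_fun y : E := f (sval (cid (p_surj y))).

Lemma factor_funE x : factor_fun (p x) = f x.
Proof.
rewrite /factor_fun; case: cid => x' /= px.
have : f (x' - x) = 0 by rewrite pf// raddfB /= px subrr.
by rewrite raddfB /= => /eqP; rewrite subr_eq0 => /eqP.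
Qed.

Lemma factor_subproof (c : fcomb R D) :
  factor_fun (contract c) = contract (push factor_fun c).
Proof.
pose s y := sval (cid (p_surj y)).
have ps y : p (s y) = y := svalP (cid (p_surj y)).
(* The section [s] need not be a homomorphism, but it still writes [c] as the image under [p] of a
   combination over [C]. *)
rewrite -[in LHS](push_id c) -(eq_push (f := p \o s))// -push_comp.
by rewrite -ch_contract factor_funE ch_contract push_comp.
Qed.

Definition factor : contra_hom D E := ContraHom factor_subproof.

Lemma factorE x : factor (p x) = f x.
Proof. exact: factor_funE. Qed.
End Factor.

Section Cokernel.
Variables (R : crlTopRingType) (K X : contramodType R) (u : contra_hom K X).

Definition coker_contra : Type := {ideal_quot (im_pred u)}.
HB.instance Definition _ := Choice.copy coker_contra {ideal_quot (im_pred u)}.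

Definition coker_pi (x : X) : coker_contra := \pi_{ideal_quot (im_pred u)} x.
Definition coker_repr (y : coker_contra) : X := repr y.

Lemma coker_piK y : coker_pi (coker_repr y) = y.
Proof. exact: reprK. Qed.

Lemma eq_coker_pi x y : coker_pi x = coker_pi y <-> exists k, u k = x - y.
Proof.
rewrite /coker_pi; split=> [/eqP|[k uk]].
  by rewrite -Quotient.idealrBE => /asboolP[k _ uk]; exists k.
by apply/eqP; rewrite -Quotient.idealrBE; apply/asboolP; exists k.
Qed.

(* [x - repr x] lies in the image of [u], so the same is true of a formal
   combination of such differences. *)
Lemma coker_pi_contract (c : fcomb R X) :
  coker_pi (contract (push (coker_repr \o coker_pi) c)) = coker_pi (contract c).
Proof.
have uP x : exists k, u k = coker_repr (coker_pi x) - x.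
  by apply/eq_coker_pi; rewrite coker_piK.
pose k x := sval (cid (uP x)).
have uk x : u (k x) = coker_repr (coker_pi x) - x := svalP (cid (uP x)).
apply/eq_coker_pi; exists (contract (push k c)); rewrite ch_contract push_comp.
rewrite -contractB -[X in _ - X]push_id.
rewrite -[X in X - _]flat_push_unit -[X in _ - X]flat_push_unit.
(* Each difference is the contraaction of a two-term combination, so the sum of all of them is
   computed by opening parentheses. *)
have -> : u \o k = fun x => contract
    (funit R (coker_repr (coker_pi x)) - funit R x).
  by apply: funext => x; rewrite /= uk contractB !contract_unit.
rewrite contract_push_contract; congr contract.
apply: fcombP => y; rewrite fcombB !flat_pushE -tsum_zmod; first last.
- by apply: (sub_null (fcoefP c)) => I x [_ [_ IM]] /IM.
- by apply: (sub_null (fcoefP c)) => I x [_ [_ IM]] /IM.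
by congr tsum; apply: funext => x; rewrite fcombB mulrBr.
Qed.

Definition coker_contract (c : fcomb R coker_contra) : coker_contra :=
  coker_pi (contract (push coker_repr c)).

(** The contraaction does not depend on the chosen representatives, which makes the projection a
    homomorphism. *)
Lemma coker_contract_push (c : fcomb R X) :
  coker_contract (push coker_pi c) = coker_pi (contract c).
Proof. by rewrite /coker_contract push_comp coker_pi_contract. Qed.

Lemma coker_contract_assoc (c : fcomb R (fcomb R coker_contra)) :
  coker_contract (push coker_contract c) = coker_contract (flat c).
Proof.
rewrite [RHS]/coker_contract -flat_push_push -contract_push_contract.
rewrite -coker_contract_push push_comp.
by congr coker_contract; apply: eq_push.
Qed.

Lemma coker_contract_unit y : coker_contract (funit R y) = y.
Proof. by rewrite /coker_contract push_unit contract_unit coker_piK. Qed.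

HB.instance Definition _ :=
  isContramodule.Build R coker_contra coker_contract_assoc coker_contract_unit.

Definition coker_hom : contra_hom X coker_contra :=
  @ContraHom R X coker_contra coker_pi (fun c => esym (coker_contract_push c)).

Lemma coker_hom_surj y : exists x, coker_hom x = y.
Proof. by exists (coker_repr y); exact: coker_piK. Qed.

Lemma coker_hom_eq x y : coker_hom x = coker_hom y <-> exists k, u k = x - y.
Proof. exact: eq_coker_pi. Qed.
End Cokernel.

(** * The contramodule of homomorphisms [N -> A] *)

Lemma zmod_morphism0 (U V : zmodType) (f : U -> V) : zmod_morphism f -> f 0 = 0.
Proof. by move=> fB; rewrite -[X in f X](subrr 0) fB subrr. Qed.

Lemma zmod_morphismD (U V : zmodType) (f : U -> V) :
  zmod_morphism f -> {morph f : x y / x + y}.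
Proof.
move=> fB x y.
by rewrite -{1}[y]opprK fB -(sub0r y) fB (zmod_morphism0 fB) sub0r opprK.
Qed.

Section Evaluation.
Variables (R : crlTopRingType) (N : discrete_rmodule R) (A : zmodType).

(* The sum is finite: [b] is annihilated by all but finitely many [c x]. *)
Definition fc_eval (X : choiceType) (ev : X -> N -> A) (b : N)
    (c : fcomb R X) : A :=
  \sum_(x \in [set: X]) ev x (ract b (c x)).

Lemma fcomb_support (X : choiceType) (b : N) (c : fcomb R X) :
  exists S : {fset X}, forall x, x \notin S -> ract b (c x) = 0.
Proof. exact: null_support (fcoefP c) (ann_open_right_ideal b). Qed.

Lemma ract_tsum_fset (X : choiceType) (b : N) (r : X -> R) (S : {fset X}) :
    r \in null_pred -> (forall x, x \notin S -> ract b (r x) = 0) ->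
  ract b (tsum r) = \sum_(x <- S) ract b (r x).
Proof.
move=> rP bS; have := tsumP rP (ann_open_right_ideal b) bS.
rewrite /= ractBr => /eqP; rewrite subr_eq0 => /eqP ->.
exact: (big_morph (ract b) (ractDr b) (ract0 b)).
Qed.

Section Additive.
Variables (X : choiceType) (ev : X -> N -> A).
Hypothesis evB : forall x, zmod_morphism (ev x).

Lemma fc_evalE (b : N) (c : fcomb R X) (S : {fset X}) :
    (forall x, x \notin S -> ract b (c x) = 0) ->
  fc_eval ev b c = \sum_(x <- S) ev x (ract b (c x)).
Proof. by move=> bc; apply: fsbigTE => x /bc ->; exact: zmod_morphism0. Qed.

Lemma fc_evalB (a b : N) (c : fcomb R X) :
  fc_eval ev (a - b) c = fc_eval ev a c - fc_eval ev b c.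
Proof.
have [S aS] := fcomb_support a c; have [T bT] := fcomb_support b c.
have aB x : ract (a - b) (c x) = ract a (c x) - ract b (c x).
  exact: scalerBr.
rewrite !(@fc_evalE _ _ (S `|` T)%fset).
- by rewrite -sumrB; apply: eq_bigr => x _; rewrite aB evB.
- by move=> x; rewrite inE negb_or => /andP[_ /bT].
- by move=> x; rewrite inE negb_or => /andP[/aS].
- by move=> x; rewrite inE negb_or aB => /andP[/aS -> /bT ->]; rewrite subrr.
Qed.

Lemma fc_evalBr (b : N) (c d : fcomb R X) :
  fc_eval ev b (c - d) = fc_eval ev b c - fc_eval ev b d.
Proof.
have [S cS] := fcomb_support b c; have [T dT] := fcomb_support b d.
rewrite !(@fc_evalE _ _ (S `|` T)%fset).
- by rewrite -sumrB; apply: eq_bigr => x _; rewrite fcombB ractBr evB.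
- by move=> x; rewrite inE negb_or => /andP[_ /dT].
- by move=> x; rewrite inE negb_or => /andP[/cS].
- move=> x; rewrite inE negb_or fcombB ractBr => /andP[/cS -> /dT ->].
  exact: subrr.
Qed.

Lemma fc_eval_unit (b : N) x : fc_eval ev b (funit R x) = ev x b.
Proof.
rewrite (@fc_evalE _ _ [fset x]%fset) => [|y].
  by rewrite big_seq_fset1 /= eqxx /ract scale1r.
by rewrite inE /= => /negbTE ->; exact: ract0.
Qed.

(** Both sides expand to one finite double sum; the result becomes contraassociativity for
    [hom_contra]. *)
Lemma fc_eval_flat_push (Y : choiceType) (b : N) (a : Y -> fcomb R X)
    (c : fcomb R Y) :
  fc_eval ev b (flat (push a c)) = fc_eval (fun y b' => fc_eval ev b' (a y)) b c.
Proof.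
have [S bS] := fcomb_support b c.
(* The finite set [U] collects the supports of the inner combinations for all [y] in [S], so one
   rectangle serves both orders of summation. *)
pose T y := sval (cid (fcomb_support (ract b (c y)) (a y))).
have bT y x : x \notin T y -> ract (ract b (c y)) (a y x) = 0.
  exact: (svalP (cid (fcomb_support (ract b (c y)) (a y)))).
pose U : {fset X} := [fset x | y in S, x in T y]%fset.
have bU y x : y \in S -> x \notin U -> ract (ract b (c y)) (a y x) = 0.
  move=> yS xU; apply: bT; apply: contra xU => xT.
  by apply/imfset2P; exists y => //; exists x.
have bE x : ract b (flat (push a c) x) =
    \sum_(y <- S) ract (ract b (c y)) (a y x).
  rewrite flat_pushE (@ract_tsum_fset _ _ _ S).
  - by apply: eq_bigr => y _; rewrite ractM.
  - by apply: (sub_null (fcoefP c)) => I y [_ [_ IM]] /IM.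
  - by move=> y yS; rewrite ractM bS// /ract scaler0.
rewrite (@fc_evalE _ _ U) => [|x xU]; last first.
  by rewrite bE big_seq big1// => y yS; exact: bU.
have -> : fc_eval (fun y b' => fc_eval ev b' (a y)) b c =
    \sum_(y <- S) fc_eval ev (ract b (c y)) (a y).
  apply: fsbigTE => y /bS ->; rewrite (@fc_evalE _ _ fset0).
    by rewrite big_seq_fset0.
  by move=> x _; rewrite /ract scaler0.
under eq_bigr => x _ do rewrite bE (big_morph (ev x) (zmod_morphismD (evB x))
  (zmod_morphism0 (evB x))).
rewrite exchange_big big_seq [RHS]big_seq; apply: eq_bigr => y yS.
by rewrite (@fc_evalE _ _ U)// => x; exact: bU.
Qed.
End Additive.

Lemma fc_eval_push (X Y : choiceType) (ev : Y -> N -> A) (b : N) (f : X -> Y)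
    (c : fcomb R X) :
  (forall y, zmod_morphism (ev y)) ->
  fc_eval ev b (push f c) = fc_eval (fun x => ev (f x)) b c.
Proof.
move=> evB; rewrite -flat_push_unit fc_eval_flat_push//.
by congr fc_eval; do 2![apply: funext => ?]; rewrite fc_eval_unit.
Qed.
End Evaluation.

Section HomContra.
Variables (R : crlTopRingType) (N : discrete_rmodule R) (A : zmodType).

Record hom_contra : Type :=
  HomContra { hom_fun :> N -> A; hom_funP : `[< zmod_morphism hom_fun >] }.
HB.instance Definition _ := [isSub for hom_fun].
HB.instance Definition _ := [Choice of hom_contra by <:].

Lemma hom_funB (f : hom_contra) : zmod_morphism f.
Proof. exact/asboolP/hom_funP. Qed.

Lemma hom_contraP (f g : hom_contra) : f =1 g -> f = g.
Proof. by move=> fg; apply: val_inj; exact: funext. Qed.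

Lemma hom_contract_subproof (c : fcomb R hom_contra) :
  `[< zmod_morphism (fun b => fc_eval hom_fun b c) >].
Proof. by apply/asboolP => a b; rewrite fc_evalB//; exact: hom_funB. Qed.

(** The contraaction sends the combination of the [f] with coefficients [r_f] to the map taking [b]
    to the sum of the [f (b r_f)]. *)
Definition hom_contract (c : fcomb R hom_contra) : hom_contra :=
  HomContra (hom_contract_subproof c).

Lemma hom_contract_assoc (c : fcomb R (fcomb R hom_contra)) :
  hom_contract (push hom_contract c) = hom_contract (flat c).
Proof.
apply: hom_contraP => b /=; rewrite -[c in RHS]push_id.
by rewrite fc_eval_push ?fc_eval_flat_push//; exact: hom_funB.
Qed.

Lemma hom_contract_unit f : hom_contract (funit R f) = f.
Proof. by apply: hom_contraP => b /=; rewrite fc_eval_unit//; exact: hom_funB. Qed.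

HB.instance Definition _ :=
  isContramodule.Build R hom_contra hom_contract_assoc hom_contract_unit.

Definition homc : contramodType R := hom_contra.

Lemma contract_homE (X : choiceType) (h : X -> homc) (c : fcomb R X) b :
  (contract (push h c) : homc) b = fc_eval h b c.
Proof. by rewrite /contract /= fc_eval_push//; exact: hom_funB. Qed.

(** Addition in [homc N A] is derived from the contraaction; this identifies it with pointwise
    addition. *)
Lemma hom_evalB b : zmod_morphism (fun f : homc => f b).
Proof.
move=> f g; rewrite -[f in LHS]contract_unit -[g in LHS]contract_unit.
rewrite -contractB /contract /= fc_evalBr; last exact: hom_funB.
by rewrite !fc_eval_unit//; exact: hom_funB.
Qed.

Lemma hom_evalD b (f g : homc) : (f + g) b = f b + g b.
Proof. exact: (zmod_morphismD (hom_evalB b)). Qed.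
End HomContra.

(** * Contratensor product *)

Lemma coker_proj_eq0 (A B : zmodType) (f : {additive A -> B}) y :
  coker_proj f y = 0 <-> exists x, f x = y.
Proof.
split=> [/eqP|[x fx]].
  by rewrite pi_quot_eq0 => /asboolP[x _ fx]; exists x.
by apply/eqP; rewrite pi_quot_eq0; apply/asboolP; exists x.
Qed.

(** * The adjunction between [N (.) -] and homomorphisms out of [N] *)

Section Adjunction.
Variables (R : crlTopRingType) (N : discrete_rmodule R) (P : contramodType R).

Definition ctens (b : N) (p : P) : contratensor N P :=
  coker_proj (@ctens_diff R N P) (tens_pure b p).

Lemma ctensB p : zmod_morphism (ctens^~ p).
Proof.
move=> a b; apply: (addIr (ctens b p)).
by rewrite subrK /ctens -raddfD -tens_pureDl subrK.
Qed.

(** The defining relation of the cokernel at the tensor of [b] and [c]; it makes the curried map a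
    homomorphism. *)
Lemma ctens_contract b (c : fcomb R P) :
  ctens b (contract c) = fc_eval (fun p b' => ctens b' p) b c.
Proof.
have [S bS] := fcomb_support b c.
rewrite (@fc_evalE _ _ _ _ _ ctensB _ _ S)//.
rewrite -(raddf_sum (coker_proj (@ctens_diff R N P))) /=.
rewrite -(comb_tensE bS); apply/eqP; rewrite -subr_eq0 -raddfB.
apply/eqP/coker_proj_eq0; exists (tens_pure b c).
by rewrite /= /ctens_diff tens_mapE tens_liftE.
Qed.

Lemma ctens_ext (M : zmodType) (u v : {additive contratensor N P -> M}) :
  (forall b p, u (ctens b p) = v (ctens b p)) -> u =1 v.
Proof.
move=> uv x; rewrite -[x]reprK.
rewrite -[LHS]/((u \o coker_proj (@ctens_diff R N P)) (repr x)).
rewrite -[RHS]/((v \o coker_proj (@ctens_diff R N P)) (repr x)).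
exact: tens_ext.
Qed.

Variable A : zmodType.

Section Curry.
Variable f : {additive contratensor N P -> A}.

Lemma curry_subproof p : `[< zmod_morphism (fun b => f (ctens b p)) >].
Proof. by apply/asboolP => a b; rewrite ctensB raddfB. Qed.

Definition ctens_curry_fun p : homc N A := HomContra (curry_subproof p).

Lemma ctens_curry_contract (c : fcomb R P) :
  ctens_curry_fun (contract c) = contract (push ctens_curry_fun c).
Proof.
apply: hom_contraP => b; rewrite contract_homE /= ctens_contract.
have [S bS] := fcomb_support b c.
rewrite (@fc_evalE _ _ _ _ _ ctensB _ _ S)// raddf_sum.
rewrite (@fc_evalE _ _ _ _ _ _ _ _ S)// => p.
exact: hom_funB (ctens_curry_fun p).
Qed.

Definition ctens_curry : contra_hom P (homc N A) := ContraHom ctens_curry_contract.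

Lemma ctens_curryE p b : ctens_curry p b = f (ctens b p).
Proof. by []. Qed.
End Curry.

Section Lift.
Variable h : contra_hom P (homc N A).

Lemma ctens_lift_Dl (b b' : N) p : h p (b + b') = h p b + h p b'.
Proof. exact: (zmod_morphismD (hom_funB (h p))). Qed.

Lemma ctens_lift_Dr (b : N) p p' : h (p + p') b = h p b + h p' b.
Proof. by rewrite raddfD hom_evalD. Qed.

(** The relations of the contratensor product are killed precisely because [h] commutes with
    contraactions. *)
Lemma ctens_lift_subproof x : x \in im_pred (@ctens_diff R N P) ->
  tens_lift (Biadditive ctens_lift_Dl ctens_lift_Dr) x = 0.
Proof.
set l := tens_lift _; move=> /asboolP[t _ <-].
rewrite -[LHS]/((l \o @ctens_diff R N P) t) -[RHS]/((\0 : {additive _ -> _}) t).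
apply: tens_ext => b c /=; rewrite /ctens_diff tens_mapE tens_liftE /= raddfB /=.
have [S bS] := fcomb_support b c; rewrite (comb_tensE bS) raddf_sum /=.
rewrite /l tens_liftE /= ch_contract contract_homE.
rewrite (@fc_evalE _ _ _ _ _ _ _ _ S)// => [|p]; last exact: hom_funB.
by rewrite (eq_bigr _ (fun p _ => tens_liftE _ _ _)) subrr.
Qed.

Definition ctens_lift : contratensor N P -> A := quot_lift ctens_lift_subproof.
HB.instance Definition _ :=
  GRing.Additive.copy ctens_lift (quot_lift ctens_lift_subproof).

Lemma ctens_liftE b p : ctens_lift (ctens b p) = h p b.
Proof. by rewrite /ctens_lift quot_liftE /= tens_liftE. Qed.
End Lift.
End Adjunction.

(** * Right exactness of the contratensor product *)

Section RightExact.
Variables (R : crlTopRingType) (N : discrete_rmodule R).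

Lemma contratensor_mapE (P Q : contramodType R) (f : contra_hom P Q) b p :
  contratensor_map N f (ctens b p) = ctens b (f p).
Proof. by rewrite /contratensor_map /coker_map quot_liftE /= tens_mapE. Qed.

Lemma contratensor_map_comp (P Q S : contramodType R) (g : contra_hom Q S)
    (f : contra_hom P Q) (h : contra_hom P S) t :
  (forall x, g (f x) = h x) ->
  contratensor_map N g (contratensor_map N f t) = contratensor_map N h t.
Proof.
move=> gf.
rewrite -[LHS]/((contratensor_map N g \o contratensor_map N f) t).
by apply: ctens_ext => b p; rewrite /= !contratensor_mapE gf.
Qed.

Lemma contratensor_mapK (P Q : contramodType R) (g : contra_hom Q P)
    (f : contra_hom P Q) t :
  (forall x, g (f x) = x) -> contratensor_map N g (contratensor_map N f t) = t.
Proof.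
move=> gf.
rewrite -[LHS]/((contratensor_map N g \o contratensor_map N f) t).
rewrite -[RHS]/(idfun t).
by apply: ctens_ext => b p; rewrite /= !contratensor_mapE gf.
Qed.

(** The projection to the cokernel of [N (.) f] vanishes on all [ctens b y], hence is zero. *)
Lemma contratensor_map_surj (P Q : contramodType R) (f : contra_hom P Q) :
  (forall y, exists x, f x = y) ->
  forall t, exists s, contratensor_map N f s = t.
Proof.
move=> fs t; apply/coker_proj_eq0; set q := coker_proj _.
rewrite -[RHS]/((\0 : {additive _ -> _}) t).
apply: ctens_ext => b y /=; have [x <-] := fs y.
by apply/coker_proj_eq0; exists (ctens b x); rewrite /= contratensor_mapE.
Qed.

(** The projection [q] to the cokernel of [N (.) u], once curried, kills the kernel of [p] and
    factors through [Q]. Transposing back factors [q] through [N (.) p]. *)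
Lemma contratensor_exact (K P Q : contramodType R) (u : contra_hom K P)
    (p : contra_hom P Q) :
  (forall y, exists x, p x = y) -> (forall x, p x = 0 -> exists k, u k = x) ->
  forall t, contratensor_map N p t = 0 -> exists s, contratensor_map N u s = t.
Proof.
move=> ps pu t pt; apply/coker_proj_eq0; set q := coker_proj _.
pose f := ctens_curry q.
have pf x : p x = 0 -> f x = 0.
  move=> /pu[k <-]; apply: hom_contraP => b.
  rewrite (zmod_morphism0 (@hom_evalB _ _ _ b)) ctens_curryE.
  by apply/coker_proj_eq0; exists (ctens b k); rewrite /= contratensor_mapE.
suff <- : (ctens_lift (factor ps pf) \o contratensor_map N p) t = q t.
  by rewrite /= pt raddf0.
apply: ctens_ext => b x /=.
by rewrite contratensor_mapE ctens_liftE factorE ctens_curryE.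
Qed.
End RightExact.

(** * Resolutions and the vanishing of [Ctrtor_1] *)

Section Kernel.
Variables (R : crlTopRingType) (C D : contramodType R) (f : contra_hom C D).

Definition kernel : contramodType R := equalizer f (ch_zero C D).
Definition ker_incl : contra_hom kernel C := eqz_incl f (ch_zero C D).

Lemma ker_inclP k : f (ker_incl k) = 0.
Proof. exact: (eqz_inclP k). Qed.

Lemma ker_incl_inj : injective ker_incl.
Proof. exact: eqz_incl_inj. Qed.

Definition ker_lift (Z : contramodType R) (h : contra_hom Z C)
  (fh : forall z, f (h z) = 0) : contra_hom Z kernel :=
  @eqz_lift R C D f (ch_zero C D) Z h fh.

Lemma ker_liftE (Z : contramodType R) (h : contra_hom Z C)
  (fh : forall z, f (h z) = 0) z : ker_incl (ker_lift fh z) = h z.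
Proof. by []. Qed.

Lemma ker_inclK x : f x = 0 -> exists k, ker_incl k = x.
Proof. by move=> fx; exists (@Equalizer R C D f (ch_zero C D) x (introT eqP fx)). Qed.
End Kernel.

(** * Resolutions with a prescribed first step *)

Section FreeResolution.
Variable R : crlTopRingType.

(** Bundling source and target lets the passage to the next syzygy be iterated although both
    change. *)
Record arrow := Arrow {
  dom : contramodType R; cod : contramodType R; arr : contra_hom dom cod }.

Definition syzygy (f : arrow) : arrow :=
  @Arrow (free_contra R (kernel (arr f))) (dom f)
    (ch_comp (ker_incl (arr f)) (free_extend id)).

Lemma syzygy_exact (f : arrow) (x : dom f) :
  arr f x = 0 <-> exists y, arr (syzygy f) y = x.
Proof.
split=> [/ker_inclK[k <-]|[y <-]]; last exact: ker_inclP.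
by exists (funit R k); rewrite -[k in RHS](free_extendU id).
Qed.

Fixpoint syzygies (f : arrow) (n : nat) : arrow :=
  if n is m.+1 then syzygy (syzygies f m) else f.

Variables (P C : contramodType R) (f : contra_hom P C).
Hypotheses (P_proj : projective P) (f_surj : forall y, exists x, f x = y).

Let tower := syzygies (Arrow f).

Lemma syzygies_projective n : projective (dom (tower n)).
Proof. by case: n => [|n]; [exact: P_proj|exact: free_projective]. Qed.

(** The given [f] is kept as the augmentation, so the resolution can be fitted to a chosen
    surjection. *)
Definition free_resolution : proj_resolution C :=
  @ProjResolution R C (fun n => dom (tower n)) (fun n => arr (tower n.+1)) f
    syzygies_projective f_surj (syzygy_exact (f := Arrow f))
    (fun n => syzygy_exact (f := tower n.+1)).
End FreeResolution.

(** * [Ctrtor_1] as a kernel *)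

Section Ctrtor1.
Variables (R : crlTopRingType) (N : discrete_rmodule R) (C : contramodType R).
Variable P : proj_resolution C.

Lemma contratensor_map0 (K L : contramodType R) (f : contra_hom K L) t :
  (forall x, f x = 0) -> contratensor_map N f t = 0.
Proof.
move=> f0; rewrite -[RHS]/((\0 : {additive _ -> _}) t).
apply: ctens_ext => b x /=; rewrite contratensor_mapE f0.
(* [ctens b 0] is the curried identity at [0], evaluated at [b]. *)
rewrite -[LHS]/(ctens_curry (idfun : {additive _ -> _}) 0 b) raddf0.
exact: (zmod_morphism0 (hom_evalB b)).
Qed.

Lemma aug_diff (x : P 1) : pr_aug P (pr_diff P 0 x) = 0.
Proof. by apply/pr_exact0; exists x. Qed.

Let e : contra_hom (P 1) (kernel (pr_aug P)) := ker_lift aug_diff.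

Let eE t : contratensor_map N (ker_incl (pr_aug P)) (contratensor_map N e t) =
  contratensor_map N (pr_diff P 0) t.
Proof. exact: contratensor_map_comp. Qed.

Let e_surj y : exists x, e x = y.
Proof.
have /pr_exact0[x dx] := ker_inclP y.
by exists x; apply: ker_incl_inj; rewrite ker_liftE.
Qed.

Let e_eq0 x : e x = 0 <-> pr_diff P 0 x = 0.
Proof.
rewrite -(ker_liftE aug_diff) -/e; split=> [->|ex]; first by rewrite raddf0.
by apply: ker_incl_inj; rewrite raddf0.
Qed.

(** With [K] the kernel of the augmentation, [P_2 -> P_1 -> K -> 0] is exact and stays so under
    [N (.) -]. Hence [Ctrtor_1] is the kernel of [N (.) K -> N (.) P_0]. *)
Lemma Ctrtor1_eq0P : (forall x : Ctrtor N P 1, x = 0) <->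
  (forall t, contratensor_map N (ker_incl (pr_aug P)) t = 0 -> t = 0).
Proof.
split=> [tor0 t ut|inj x].
  have [s st] := @contratensor_map_surj _ N _ _ _ e_surj t.
  have ds : s \in ker_pred (ctrtor_out N P 1).
    by rewrite unfold_in /= -eE st ut.
  have /eqP := tor0 (\pi_{ideal_quot (@bound_pred _ _ _
    (contratensor_map N (pr_diff P 1)) (ctrtor_out N P 1))} (Ker ds)).
  rewrite pi_quot_eq0 => /asboolP[r _ /= rs].
  (* The cycle [s] over [t] is a boundary, and the composition of [e] with the differential from
     [P_2] is zero. *)
  rewrite -st -rs (@contratensor_map_comp _ _ _ _ _ _ _ (ch_comp e (pr_diff P 1)))//.
  apply: contratensor_map0 => y /=; apply/e_eq0/pr_exact.
  by exists y.
rewrite -[x]reprK; set z := repr x; apply/eqP; rewrite pi_quot_eq0.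
have := ker_valP z; rewrite unfold_in /= -eE => /eqP/inj ez.
have [|r rz] := @contratensor_exact _ N _ _ _ (pr_diff P 1) _ e_surj _ _ ez.
  by move=> y /e_eq0/pr_exact.
by apply/asboolP; exists r.
Qed.
End Ctrtor1.

(** * Pullbacks and direct limits *)

Section FlatKernel.
Variables (R : crlTopRingType) (N : discrete_rmodule R).
Variables (E F : contramodType R) (p : contra_hom E F).
Hypotheses (p_surj : forall y, exists x, p x = y) (flatF : strictly_flat1 F).

(* A resolution of [F] whose first step factors through [p]; the kernel of
   [P -> F] then surjects onto that of [p]. *)
Lemma contratensor_ker_inj t : contratensor_map N (ker_incl p) t = 0 -> t = 0.
Proof.
pose eps : contra_hom (free_contra R E) E := free_extend id.
have epsU x : eps (funit R x) = x by exact: (@free_extendU R E E id).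
have eps_surj y : exists x, eps x = y by exists (funit R y).
pose f := ch_comp p eps.
have f_surj y : exists x, f x = y.
  by have [x <-] := p_surj y; exists (funit R x); rewrite /= -[in RHS](epsU x).
have /Ctrtor1_eq0P inj := flatF (N := N)
  (P := free_resolution (@free_projective R E) f_surj).
have fk k : p (ch_comp eps (ker_incl f) k) = 0 by exact: (ker_inclP (f := f)).
pose v := ker_lift fk.
have v_surj k : exists x, v x = k.
  have /(@ker_inclK _ _ _ f)[x xk] : f (funit R (ker_incl p k)) = 0.
    by rewrite -[LHS]/(p (eps _)) epsU ker_inclP.
  exists x; apply: ker_incl_inj; rewrite ker_liftE -[LHS]/(eps (ker_incl f x)).
  by rewrite xk epsU.
have fk' k : f (ker_incl eps k) = 0.
  by rewrite -[LHS]/(p (eps _)) ker_inclP raddf0.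
pose w := ker_lift fk'.
move=> ut; have [s st] := @contratensor_map_surj _ N _ _ _ v_surj t.
(* The image of [s] in [N (.) E] is that of [t], which is zero, so its image in the contratensor
   product with the free contramodule comes from the kernel of [eps]. *)
have [||r rs] := @contratensor_exact _ N _ _ _ (ker_incl eps) eps eps_surj _
    (contratensor_map N (ker_incl f) s).
- by move=> x; exact: ker_inclK.
- rewrite (@contratensor_map_comp _ _ _ _ _ _ _ (ch_comp (ker_incl p) v)) //.
  by rewrite -ut -st; symmetry; exact: contratensor_map_comp.
(* Flatness of [F] moves the equality back to the kernel of [f]: [s] comes from the kernel of [eps]
   through [w], and [v] kills the image of [w]. *)
have : s - contratensor_map N w r = 0.
  apply: inj; rewrite raddfB /= -[X in X - _]rs.
  by rewrite (@contratensor_map_comp _ _ _ _ _ _ _ (ker_incl eps))// subrr.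
move=> /eqP; rewrite subr_eq0 => /eqP sw.
rewrite -st sw (@contratensor_map_comp _ _ _ _ _ _ _ (ch_comp v w))//.
apply: contratensor_map0 => x; apply: ker_incl_inj.
by rewrite raddf0 /= -[LHS]/(eps (ker_incl eps x)) ker_inclP.
Qed.
End FlatKernel.

Section Pullback.
Variables (R : crlTopRingType) (P F L : contramodType R).
Variables (pi : contra_hom P L) (c : contra_hom F L).

Definition pullback : contramodType R :=
  equalizer (ch_comp pi (pfst P F)) (ch_comp c (psnd P F)).
Definition pb_incl : contra_hom pullback (prod_contra P F) :=
  eqz_incl (ch_comp pi (pfst P F)) (ch_comp c (psnd P F)).
Definition pb_fst : contra_hom pullback P := ch_comp (pfst P F) pb_incl.
Definition pb_snd : contra_hom pullback F := ch_comp (psnd P F) pb_incl.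

Lemma pb_square x : pi (pb_fst x) = c (pb_snd x).
Proof. exact: (eqz_inclP x). Qed.

Lemma pb_eq x y : pb_fst x = pb_fst y -> pb_snd x = pb_snd y -> x = y.
Proof.
move=> xy1 xy2; apply: eqz_incl_inj.
rewrite -[LHS]/(pb_incl x) -[RHS]/(pb_incl y).
move: xy1 xy2; rewrite /pb_fst /pb_snd /=.
by case: (eqz_val x) (eqz_val y) => [? ?] [? ?] /= -> ->.
Qed.

Lemma pb_ex p y : pi p = c y -> exists2 x, pb_fst x = p & pb_snd x = y.
Proof.
move=> py.
by exists (@Equalizer R _ _ (ch_comp pi (pfst P F)) (ch_comp c (psnd P F))
  (p, y) (introT eqP py)).
Qed.

Section Lift.
Variables (Z : contramodType R) (f : contra_hom Z P) (g : contra_hom Z F).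
Hypothesis fg : forall z, pi (f z) = c (g z).

Definition pb_lift : contra_hom Z pullback :=
  @eqz_lift R _ _ (ch_comp pi (pfst P F)) (ch_comp c (psnd P F)) Z
    (ch_pair f g) fg.

Lemma pb_lift_fst z : pb_fst (pb_lift z) = f z.
Proof. by []. Qed.
End Lift.
End Pullback.
Arguments pb_fst {R P F L pi c}.
Arguments pb_snd {R P F L pi c}.

(** * Pulling a direct limit back along a surjection *)

Section PullbackColimit.
Variables (R : crlTopRingType) (d : Order.disp_t) (I : porderType d).
Variables (F : diagram R I) (L : contramodType R) (c : cocone F L).
Hypotheses (dirI : directed I) (colim : is_colimit c).
Variables (P : contramodType R) (pi : contra_hom P L).
Hypothesis pi_surj : forall y, exists x, pi x = y.

Let E i := pullback pi (c i).

Let E_surj i y : exists x, @pb_snd R P (F i) L pi (c i) x = y.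
Proof.
have [p pc] := pi_surj (c i y).
by have [x _ <-] := pb_ex pc; exists x.
Qed.

Variables (M : contramodType R) (g : forall i, contra_hom (E i) M).
(** Compatibility with the transition maps of the pullbacks, stated on elements so that those maps
    are not yet constructed. *)
Hypothesis g_compat : forall i j (ij : (i <= j)%O) (x : E i) (y : E j),
  pb_fst x = pb_fst y -> dg_map F ij (pb_snd x) = pb_snd y -> g j y = g i x.

Let kp i k : pi (ker_incl pi k) = c i (ch_zero (kernel pi) (F i) k).
Proof. by rewrite ker_inclP raddf0. Qed.
Let kappa i : contra_hom (kernel pi) (E i) := pb_lift (kp i).

(** Every projection [E i -> F i] has a copy of the kernel of [pi] as its kernel. The maps [g i]
    agree there, as a common upper bound of the indices shows. *)
Lemma cocone_kernel_eq i j (x : E i) (y : E j) :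
  pb_fst x = pb_fst y -> pb_snd x = 0 -> pb_snd y = 0 -> g i x = g j y.
Proof.
move=> xy x0 y0; have [k [ik jk]] := dirI.2 i j.
have [|z z1 z2] := @pb_ex R P (F k) L pi (c k) (pb_fst x) 0.
  by rewrite pb_square x0 !raddf0.
rewrite -(g_compat (ij := ik) (y := z)) ?z1 ?z2 ?x0 ?raddf0//.
by rewrite -(g_compat (ij := jk) (x := y) (y := z)) ?z1 ?z2 ?y0 ?raddf0.
Qed.

(* The map is found through its graph: with [D] the pushout of [M <- ker pi -> P]
   and [h : L -> D] the map induced by the colimit, the pairs [(m, p)] whose
   class in [D] is [h (pi p)] project bijectively onto [P]. *)
Lemma pullback_cocone_extend :
  exists H : contra_hom P M, forall i (x : E i), H (pb_fst x) = g i x.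
Proof.
have [i0] := dirI.1.
pose g0 := ch_comp (g i0) (kappa i0).
have g0E i (x : E i) k : pb_fst x = ker_incl pi k -> pb_snd x = 0 -> g i x = g0 k.
  by move=> xk x0; exact: cocone_kernel_eq.
pose u := ch_pair g0 (ker_incl pi); pose q := coker_hom u.
have qP x y : q x = q y <-> exists k, u k = x - y by exact: coker_hom_eq.
have q0 x : q x = 0 <-> exists k, u k = x.
  by rewrite -(raddf0 q) qP subr0.
(* [f i] kills the kernel of [E i -> F i] and so descends to a map [t i] from [F i]; these maps form
   a cocone, which yields [h]. *)
pose f i := ch_comp q (ch_pair (g i) pb_fst).
have f0 i x : pb_snd x = 0 -> f i x = 0.
  move=> x0; have /ker_inclK[k kx] : pi (pb_fst x) = 0.
    by rewrite pb_square x0 raddf0.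
  apply/q0; exists k; apply: injective_projections; last exact: kx.
  by symmetry; apply: g0E.
pose t i := factor (@E_surj i) (@f0 i).
have tE i x : t i (pb_snd x) = f i x by exact: factorE.
have tc i j (ij : (i <= j)%O) y : t j (dg_map F ij y) = t i y.
  have [x <-] := E_surj y.
  have [|z z1 z2] := @pb_ex R P (F j) L pi (c j) (pb_fst x)
    (dg_map F ij (pb_snd x)).
    by rewrite cc_compat pb_square.
  rewrite -z2 !tE /f /=; congr (q (_, _)); last exact: z1.
  exact: (g_compat (ij := ij)).
have [h hc _] := colim (Cocone tc).
pose r0 := ch_comp pi (psnd M P).
have r00 x : q x = 0 -> r0 x = 0.
  by move=> /q0[k <-]; rewrite /r0 /= ker_inclP.
pose r := factor (@coker_hom_surj _ _ _ u) r00.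
have rq x : r (q x) = r0 x by exact: factorE.
(* On the legs of the colimit [r \o h] agrees with the identity, so uniqueness in the universal
   property applies. *)
have rh y : r (h y) = y.
  have [h' _ uniq] := colim c.
  rewrite -[LHS]/(ch_comp r h y) uniq; last first.
    move=> i z /=; rewrite [h _]hc; have [x <-] := E_surj z.
    by rewrite tE [LHS]rq -[LHS]/(pi (pb_fst x)) pb_square.
  by symmetry; exact: (uniq (ch_id L)).
pose X := equalizer q (ch_comp h r0).
pose inc : contra_hom X _ := eqz_incl q (ch_comp h r0).
pose rho := ch_comp (psnd M P) inc.
have rho_surj p : exists x, rho x = p.
  have [[m' p'] qm] := coker_hom_surj (h (pi p)).
  (* A representative [(m', p')] of [h (pi p)] has the right image in [L]; adding [u k] corrects its
     second coordinate to [p] within the same class. *)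
  have /ker_inclK[k kp'] : pi (p - p') = 0.
    rewrite raddfB /=; apply/eqP; rewrite subr_eq0; apply/eqP.
    by rewrite -[LHS]rh -qm rq.
  have Xm : q (g0 k + m', p) = h (r0 (g0 k + m', p)).
    rewrite /r0 /= -qm; apply/qP; exists k.
    apply: injective_projections.
      by rewrite -[RHS]/(pfst M P _) raddfB /= addrK.
    by rewrite -[RHS]/(psnd M P _) raddfB.
  by exists (@Equalizer R _ _ q (ch_comp h r0) _ (introT eqP Xm)).
pose H0 := ch_comp (pfst M P) inc.
have H00 x : rho x = 0 -> H0 x = 0.
  move=> rx; have /q0[k ku] : q (inc x) = 0.
    rewrite (eqz_inclP x) -[LHS]/(h (pi (rho x))) rx.
    by rewrite !raddf0.
  (* Here the inclusion of the kernel of [pi] into [P] being a monomorphism makes the graph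
     single-valued. *)
  have k0 : k = 0.
    apply: (@ker_incl_inj _ _ _ pi); rewrite raddf0 -rx.
    by rewrite -[LHS]/(psnd M P (u k)) ku.
  rewrite -[LHS]/(pfst M P (inc x)) -ku -[LHS]/(g0 k) k0.
  exact: raddf0.
exists (factor rho_surj H00) => i x.
have Xx : q (g i x, pb_fst x) = h (r0 (g i x, pb_fst x)).
  by rewrite /r0 /= pb_square [h _]hc tE.
pose z : X := @Equalizer R _ _ q (ch_comp h r0) _ (introT eqP Xx).
by rewrite -[pb_fst x]/(rho z) factorE.
Qed.
End PullbackColimit.

(** * Reduced products of abelian groups *)

Section ReducedProduct.
Variables (d : Order.disp_t) (I : porderType d) (G : I -> zmodType).

(* The reduced product of the [G i] replaces their direct limit, which embeds in
   it when the [G i] form a direct system. *)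
Definition dprod : Type := forall i, G i.
HB.instance Definition _ := gen_eqMixin dprod.
HB.instance Definition _ := gen_choiceMixin dprod.

Definition dprod_zero : dprod := fun=> 0.
Definition dprod_opp (f : dprod) : dprod := fun i => - f i.
Definition dprod_add (f g : dprod) : dprod := fun i => f i + g i.

Lemma dprod_addA : associative dprod_add.
Proof. by move=> f g h; apply: functional_extensionality_dep => i; exact: addrA. Qed.
Lemma dprod_addC : commutative dprod_add.
Proof. by move=> f g; apply: functional_extensionality_dep => i; exact: addrC. Qed.
Lemma dprod_add0 : left_id dprod_zero dprod_add.
Proof. by move=> f; apply: functional_extensionality_dep => i; exact: add0r. Qed.
Lemma dprod_addN : left_inverse dprod_zero dprod_opp dprod_add.
Proof. by move=> f; apply: functional_extensionality_dep => i; exact: addNr. Qed.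

HB.instance Definition _ :=
  GRing.isZmodule.Build dprod dprod_addA dprod_addC dprod_add0 dprod_addN.

(** The argument [directed I] records the hypothesis under which these families form a subgroup. *)
Definition eventually_zero of directed I : {pred dprod} :=
  fun f => `[< exists k, forall j, (k <= j)%O -> f j = 0 >].

Hypothesis dirI : directed I.

Lemma eventually_zero_zmod_closed : zmod_closed (eventually_zero dirI).
Proof.
split; first by apply/asboolP; have [k] := dirI.1; exists k.
move=> f g /asboolP[k fk] /asboolP[l gl]; apply/asboolP.
have [m [km lm]] := dirI.2 k l; exists m => j mj.
rewrite -[LHS]/(f j - g j) fk ?gl ?subrr//.
  exact: Order.POrderTheory.le_trans mj.
exact: Order.POrderTheory.le_trans mj.
Qed.
HB.instance Definition _ :=
  GRing.isZmodClosed.Build dprod (eventually_zero dirI) eventually_zero_zmod_closed.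

Definition reduced_prod : zmodType := {ideal_quot (eventually_zero dirI)}.
Definition reduced_pi (f : dprod) : reduced_prod :=
  \pi_{ideal_quot (eventually_zero dirI)} f.

Lemma reduced_piB : zmod_morphism reduced_pi.
Proof. exact: raddfB. Qed.

Lemma reduced_pi_eq0 f : reduced_pi f = 0 <->
  exists k, forall j, (k <= j)%O -> f j = 0.
Proof.
split=> [/eqP|fk]; first by rewrite pi_quot_eq0 => /asboolP.
by apply/eqP; rewrite pi_quot_eq0; apply/asboolP.
Qed.
End ReducedProduct.

(** * Injectivity over the direct limit *)

Section DirectLimitKernel.
Variables (R : crlTopRingType) (d : Order.disp_t) (I : porderType d).
Variables (F : diagram R I) (L : contramodType R) (c : cocone F L).
Hypotheses (dirI : directed I) (colim : is_colimit c).
Hypothesis flatF : forall i, strictly_flat1 (F i).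
Variables (N : discrete_rmodule R) (P : contramodType R) (pi : contra_hom P L).
Hypothesis pi_surj : forall y, exists x, pi x = y.

Let E i := pullback pi (c i).
Let G i : zmodType := contratensor N (E i).

Lemma pb_trans_subproof i j (ij : (i <= j)%O) (x : E i) :
  pi (pb_fst x) = c j (ch_comp (dg_map F ij) pb_snd x).
Proof. by rewrite pb_square -(cc_compat c ij). Qed.

Let trans i j (ij : (i <= j)%O) : contra_hom (E i) (E j) :=
  pb_lift (pb_trans_subproof ij).

(** The default [\0] makes the family total in [j]; only indices above [i] affect its class in the
    reduced product. *)
Let tr i j : {additive G i -> G j} :=
  match pselect (i <= j)%O with
  | left ij => contratensor_map N (trans ij)
  | right _ => \0
  end.

Let trE i j (ij : (i <= j)%O) x : tr i j x = contratensor_map N (trans ij) x.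
Proof. by rewrite /tr; case: pselect => // ij'; rewrite (bool_irrelevance ij ij'). Qed.

Let psi i (x : G i) : reduced_prod G dirI :=
  reduced_pi dirI (fun j => tr i j x : G j).

Let psiB i : zmod_morphism (@psi i).
Proof.
move=> x y; rewrite -reduced_piB; congr reduced_pi.
by apply: functional_extensionality_dep => j; exact: raddfB.
Qed.

HB.instance Definition _ i := GRing.isZmodMorphism.Build
  (G i) (reduced_prod G dirI) (@psi i) (@psiB i).

Let kappa_subproof i k :
  pi (ker_incl pi k) = c i (ch_zero (kernel pi) (F i) k).
Proof. by rewrite ker_inclP raddf0. Qed.

Let kappa i : contra_hom (kernel pi) (E i) := pb_lift (@kappa_subproof i).

(** The kernel of [pi] is a retract of the kernel of [E i -> F i], to which flatness of [F i]
    applies. *)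
Let kappa_inj i t : contratensor_map N (kappa i) t = 0 -> t = 0.
Proof.
have E_surj y : exists x : E i, pb_snd x = y.
  have [p pc] := pi_surj (c i y).
  by have [x _ <-] := pb_ex pc; exists x.
pose v := ker_lift (fun k => erefl : pb_snd (kappa i k) = 0).
have w0 x : pi (ch_comp pb_fst (ker_incl (@pb_snd R P (F i) L pi (c i))) x) = 0.
  rewrite -[LHS]/(pi (pb_fst (ker_incl (@pb_snd R P (F i) L pi (c i)) x))).
  by rewrite pb_square ker_inclP raddf0.
pose w := ker_lift w0.
move=> kt; have wv k : w (v k) = k by exact: ker_incl_inj.
rewrite -(contratensor_mapK t wv).
rewrite (contratensor_ker_inj E_surj (flatF (i := i))
  (t := contratensor_map N v t)).
  exact: raddf0.
by rewrite -kt; exact: contratensor_map_comp.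
Qed.

(** The curried maps [psi i] extend to [P], and transposing gives a map from [N (.) P] to the
    reduced product. An element dying in [N (.) P] therefore dies in some [N (.) E j], where
    [kappa_inj] applies. *)
Lemma contratensor_colimit_ker_inj t :
  contratensor_map N (ker_incl pi) t = 0 -> t = 0.
Proof.
have g_compat i j (ij : (i <= j)%O) (x : E i) (y : E j) :
    pb_fst x = pb_fst y -> dg_map F ij (pb_snd x) = pb_snd y ->
  ctens_curry (@psi j) y = ctens_curry (@psi i) x.
  move=> xy1 xy2; apply: hom_contraP => b; apply/eqP.
  rewrite !ctens_curryE -subr_eq0 -reduced_piB; apply/eqP/reduced_pi_eq0.
  exists j => k jk; have ik := Order.POrderTheory.le_trans ij jk.
  apply/eqP; rewrite subr_eq0 (trE jk) (trE ik) !contratensor_mapE.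
  apply/eqP; congr ctens; apply: pb_eq; first by rewrite !pb_lift_fst.
  rewrite -[LHS]/(dg_map F jk (pb_snd y)) -xy2.
  exact: dg_comp.
have [H HE] := pullback_cocone_extend dirI colim pi_surj g_compat.
have Hpsi i : ctens_lift H \o contratensor_map N pb_fst =1 @psi i.
  apply: ctens_ext => b x /=.
  by rewrite contratensor_mapE ctens_liftE HE ctens_curryE.
move=> ut; have [i] := dirI.1.
have : psi (contratensor_map N (kappa i) t) = 0.
  rewrite -Hpsi /= (contratensor_map_comp (h := ker_incl pi))//.
  by rewrite ut raddf0.
(* Above [k] the component vanishes; above [i] it is given by the actual transition map. *)
move=> /reduced_pi_eq0[k tr0]; have [j [kj ij]] := dirI.2 k i.
apply: (@kappa_inj j); rewrite -(tr0 j kj) (trE ij).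
symmetry; apply: contratensor_map_comp => x; apply: pb_eq => //.
by rewrite -[LHS]/(dg_map F ij 0) raddf0.
Qed.
End DirectLimitKernel.

Theorem corollary7p1 (R : crlTopRingType) (d : Order.disp_t) (I : porderType d)
    (F : diagram R I) (L : contramodType R) (c : cocone F L) :
  directed I -> is_colimit c ->
  (forall i : I, strictly_flat1 (F i)) -> strictly_flat1 L.
Proof.
move=> dirI colim flatF N P; apply/Ctrtor1_eq0P => t.
exact: (contratensor_colimit_ker_inj dirI colim flatF (@pr_aug_surj _ _ P)).
Qed.
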